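(* Let $k$ be a field of characteristic $2$ and let $q\ge 2$ be a power of $2$. Let $l,m\in\mathbb{N}$ with $l,m<2q$, let $l_1,l_2,m_1,m_2$ be integers with $0<l_1,l_2,m_1,m_2<2q$ such that $A_{l_1}B_{l_2}^{-1}$ and $A_{m_1}B_{m_2}^{-1}$ belong to $\mathcal{W}'$ (i.e. $l_1\equiv l_2$ and $m_1\equiv m_2$ modulo $2$), and let $\rho,\sigma\in k\setminus\{0\}$. All modules below are regarded as $kD_{4q}$-modules, and ''projective direct summand'' means a non-zero projective $kD_{4q}$-module direct summand. 1. $M(A_l)\otimes M(B_m)$ has a projective direct summand if, and only if, $l+m\ge 2q$. 2. $M(A_l)\otimes M(A_m)$ has a projective direct summand if, and only if, $l+m\ge 2q+1$. 3. $M(A_{l_1}B_{l_2}^{-1},\rho)\otimes M(A_m)$ has a projective direct summand precisely when $\max\{l_1+m-1,\ l_2+m\}\ge 2q$. 4. If $l_1\ne l_2$ or $m_1\ne m_2$, then $M(A_{l_1}B_{l_2}^{-1},\rho)\otimes M(A_{m_1}B_{m_2}^{-1},\sigma)$ has a projective direct summand if, and only if, $\max\{l_1+m_1-1,\ l_1+m_2,\ l_2+m_1,\ l_2+m_2-1\}\ge 2q$. 5. If $l_1=l_2$ and $m_1=m_2$, then $M(A_{l_1}B_{l_2}^{-1},\rho)\otimes M(A_{m_1}B_{m_2}^{-1},\sigma)$ has a projective direct summand if, and only if, (a) $l_1\not\perp(m_1-1)$ and $l_1+m_1\ge 2q$, or (b) $l_1\perp(m_1-1)$, $\rho\ne\sigma$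 and $l_1+m_1=2q$.
   Context: $\mathbb{N}$ contains $0$. For $n\in\mathbb{N}$, $[n]_i$ denotes the $i$th binary digit, $n=\sum_i[n]_i2^i$; $l\perp m$ means $[l]_i+[m]_i\le 1$ for all $i\in\mathbb{N}$. $D_{4q}=\langle g,h\mid g^2=h^2=(gh)^{2q}=1\rangle$ is the dihedral group of order $4q$. With $X=1+g$, $Y=1+h$ one has $kD_{4q}\cong k\langle X,Y\rangle/(X^2,Y^2,(XY)^q+(YX)^q)$. Modules are finite dimensional. Tensor products are over $k$ with diagonal group action, that is, $Z(m\otimes n)=Zm\otimes n+m\otimes Zn+Zm\otimes Zn$ for $Z\in\{X,Y\}$. Words. $\mathcal{W}$ is the set of words $a_1\cdots a_n$ ($n\ge 0$) in the letters $X,X^{-1},Y,Y^{-1}$ in which letters from $\{X,X^{-1}\}$ and $\{Y,Y^{-1}\}$ alternate; $1$ is the empty word and $(a_1\cdots a_n)^{-1}=a_n^{-1}\cdots a_1^{-1}$. $\mathcal{W}'\subset\mathcal{W}$ is the set of words of even positive length that are not powers of a shorter word and contain letters from both $\{X,Y\}$ and $\{X^{-1},Y^{-1}\}$. Put $A_0=B_0=1$, $A_{t+1}=B_tY$, $B_{t+1}=A_tX$. String modules. For $w=a_1\cdots a_n\in\mathcal{W}$, $M(w)$ has basis $e_0,\dots,e_n$, and $Z\in\{X,Y\}$ acts by $Ze_i=e_{i-1}$ if $i>0$ and $a_i=Z$; $Ze_i=e_{i+1}$ if $i<n$ and $a_{i+1}=Z^{-1}$; $Ze_i=0$ otherwise.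 Band modules (scalar case). For $w=a_1\cdots a_n\in\mathcal{W}'$ and $\rho\in k\setminus\{0\}$, $M(w,\rho)$ has basis $e_0,\dots,e_{n-1}$. Let $T$ be the linear automorphism with $T(e_i)=e_{i-1}$ for $2\le i\le n-1$, $T(e_1)=\rho e_0$, $T(e_0)=e_{n-1}$, and let $a_0:=a_n$. Then $Z\in\{X,Y\}$ acts by $Ze_i=T(e_i)$ if $a_i=Z$; $Ze_i=T^{-1}(e_i)$ if $a_{i+1}=Z^{-1}$; $Ze_i=0$ otherwise. *)

(* Defs.v *)
From HB Require Import structures.
From mathcomp Require Import all_boot all_order all_algebra all_fingroup.
From mathcomp Require Import all_solvable all_character.
From mathcomp Require Import zify.

Set Implicit Arguments.
Unset Strict Implicit.
Unset Printing Implicit Defensive.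

Import GRing.Theory.
Local Open Scope ring_scope.

Definition bit (n i : nat) : nat := (n %/ 2 ^ i %% 2)%N.

Definition perp (l m : nat) : Prop := forall i, (bit l i + bit m i <= 1)%N.

(* The letter Z is (Z, false) and its formal inverse Z^-1 is (Z, true). *)
Definition gen : Type := bool.
Definition gX : gen := false.
Definition gY : gen := true.
Definition letter : Type := (bool * bool)%type.
Definition word : Type := seq letter.

Definition inW (w : word) : bool := sorted (fun a b : letter => a.1 != b.1) w.

Definition winv (w : word) : word := rev [seq (a.1, ~~ a.2) | a : letter <- w].

Definition inWprime (w : word) : Prop :=
  [/\ inW w, ~~ odd (size w) && (0 < size w)%N,
      forall (v : word) (r : nat), (size v < size w)%N -> w <> flatten (nseq r v)
    & has (fun a : letter => ~~ a.2) w && has (fun a : letter => a.2) w].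

Fixpoint wA (t : nat) : word :=
  if t is t'.+1 then rcons (wB t') (gY, false) else [::]
with wB (t : nat) : word :=
  if t is t'.+1 then rcons (wA t') (gX, false) else [::].

Definition wAB (l1 l2 : nat) : word := wA l1 ++ winv (wB l2).

(* a_i is item i - 1 of the list a_1 ... a_n, and a_0 := a_n. *)
Definition wletter (w : word) (i : nat) : letter :=
  nth (gX, false) w (if i is i'.+1 then i' else (size w).-1).

(* Vectors are rows, as in mxrepresentation: row i of the matrix of Z is Z e_i.
   A left module over a group is read as the right module v x := x^-1 v, on
   which the involutions g and h, hence X = 1 + g and Y = 1 + h, act by the same
   operators. *)
Definition string_mx (k : fieldType) (w : word) (Z : gen) :
    'M[k]_((size w).+1) :=
  \matrix_(i, j)
    (if (0 < i)%N && (wletter w i == (Z, false)) then (i == j.+1 :> nat)%:R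
     else if (i < size w)%N && (wletter w i.+1 == (Z, true))
          then (j == i.+1 :> nat)%:R
     else 0).

Definition bandT (k : fieldType) (n : nat) (rho : k) : 'M[k]_n :=
  \matrix_(i, j)
    (if i == 0%N :> nat then (j == n.-1 :> nat)%:R
     else if i == 1%N :> nat then (if j == 0%N :> nat then rho else 0)
     else (j == i.-1 :> nat)%:R).

Definition band_mx (k : fieldType) (w : word) (rho : k) (Z : gen) :
    'M[k]_(size w) :=
  \matrix_(i, j)
    (if wletter w i == (Z, false) then bandT (size w) rho i j
     else if wletter w i.+1 == (Z, true) then invmx (bandT (size w) rho) i j
     else 0).

(* For gT = 'D_(4 * q), whose order 4q is that of the group presented by these
   relations, g and h satisfy no further ones. *)
Definition dihedral_gens (gT : finGroupType) (q : nat) (g h : gT) : Prop :=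
  [/\ <<[set g; h]>>%g = [set: gT],
      (g ^+ 2 = 1)%g, (h ^+ 2 = 1)%g & ((g * h) ^+ (2 * q) = 1)%g].

Notation Drepr k q := (mx_representation k [set: 'D_(4 * q)]%G).

(* rM is determined by M, as g and h generate the group. *)
Definition is_module_of (k : fieldType) (q : nat) (g h : 'D_(4 * q)) (n : nat)
    (M : gen -> 'M[k]_n) (rM : Drepr k q n) : Prop :=
  M gX = 1%:M + rM g /\ M gY = 1%:M + rM h.

Section Projective.

Variables (k : fieldType) (gT : finGroupType) (G : {group gT}).

Definition mxhom (m n : nat) (rU : mx_representation k G m)
    (rV : mx_representation k G n) (f : 'M[k]_(m, n)) : Prop :=
  forall x, x \in G -> rU x *m f = f *m rV x.

(* The homomorphism is v |-> v *m f, surjective when row_full f. Lifting is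
   tested in the category of finite dimensional modules. *)
Definition mxprojective (n : nat) (rP : mx_representation k G n) : Prop :=
  forall (u v : nat) (rU : mx_representation k G u)
      (rV : mx_representation k G v) (p : 'M[k]_(u, v)) (f : 'M[k]_(n, v)),
    mxhom rU rV p -> row_full p -> mxhom rP rV f ->
  exists2 s : 'M[k]_(n, u), mxhom rP rU s & s *m p = f.

Definition has_proj_summand (n : nat) (rM : mx_representation k G n) : Prop :=
  exists rP rQ : representation k G,
    [/\ (0 < rdegree rP)%N, mxprojective rP & mx_rsim rM (dadd_grepr rP rQ)].

End Projective.

Definition tensor_has_proj (k : fieldType) (q m n : nat) (rM : Drepr k q m)
    (rN : Drepr k q n) : Prop := has_proj_summand (prod_repr rM rN).

(* Sanity checks: the generators exist, membership of A_l1 B_l2^-1 in W' is the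
   parity condition, and every module of the theorem exists. *)

Lemma wA_wB t : [/\ size (wA t) = t, size (wB t) = t &
  forall i, (i < t)%N -> nth (gX, false) (wA t) i = (odd i != odd t, false) /\
    nth (gX, false) (wB t) i = (odd i == odd t, false)].
Proof.
elim: t => //= t [sA sB IH].
split; rewrite ?size_rcons ?sA ?sB // => i lti.
rewrite !nth_rcons sA sB.
have [lit|lti'|->] := ltngtP i t; last by split=> /=; case: odd.
  by have [-> ->] := IH i lit; split=> /=; do 2!case: odd.
by lia.
Qed.

Lemma size_wAB l1 l2 : size (wAB l1 l2) = (l1 + l2)%N.
Proof.
have [sA _ _] := wA_wB l1; have [_ sB _] := wA_wB l2.
by rewrite /wAB size_cat size_rev size_map sA sB.
Qed.

Lemma nth_wAB l1 l2 i : (i < l1 + l2)%N ->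
  nth (gX, false) (wAB l1 l2) i = (odd i != odd l1, l1 <= i)%N.
Proof.
have [sA _ nA] := wA_wB l1; have [_ sB nB] := wA_wB l2.
move=> lti; rewrite nth_cat sA; case: ltnP => li.
  by have [-> _] := nA i li.
rewrite nth_rev size_map sB; last by lia.
rewrite (nth_map (gX, false)) ?sB; last by lia.
have [|_ ->] := nB (l2 - (i - l1).+1)%N; first by lia.
congr pair; rewrite /=; lia.
Qed.

Lemma wAB_Wprime l1 l2 : (0 < l1)%N -> (0 < l2)%N ->
  inWprime (wAB l1 l2) <-> odd l1 = odd l2.
Proof.
move=> l1_gt0 l2_gt0; have sz := size_wAB l1 l2.
split=> [[_ /andP[]]|eq_odd]; first by rewrite sz oddD; case: (odd l1); case: (odd l2).
split.
- apply/(sortedP (gX, false)) => i; rewrite sz => lti.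
  by rewrite !nth_wAB ?(ltnW lti) //=; case: (odd l1); case: (odd i).
- by rewrite sz oddD eq_odd addbb addn_gt0 l1_gt0.
- move=> v [|[|r]] ltv def_w; first by move: sz; rewrite def_w /=; lia.
    by move: ltv; rewrite def_w /= cats0 ltnn.
  have w_r : wAB l1 l2 = flatten (nseq r.+1 v) ++ v.
    rewrite def_w; elim: r.+1 => [|s IH] /=; first by rewrite cats0.
    by rewrite -catA -IH.
  have v_gt0 : (0 < size v)%N.
    case: v def_w {w_r ltv} => // def_w; move: sz; rewrite def_w.
    have ->: flatten (nseq r.+2 ([::] : word)) = [::] by elim: r.+2.
    by move=> /= ; lia.
  have sz_r := congr1 size w_r; rewrite size_cat sz in sz_r.
  have /= v0 := nth_wAB (i := 0) (ltn_addr l2 l1_gt0).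
  have vn : nth (gX, false) (wAB l1 l2) (l1 + l2).-1 = last (gX, false) v.
    by rewrite -sz nth_last w_r last_cat; case: (v) v_gt0.
  have vs : nth (gX, false) (wAB l1 l2) (size v).-1 = last (gX, false) v.
    by rewrite def_w /= nth_cat prednK // leqnn nth_last.
  have vt : nth (gX, false) (wAB l1 l2) (size v) = nth (gX, false) (wAB l1 l2) 0.
    rewrite def_w /= !nth_cat ltnn subnn v_gt0.
    by [].
  rewrite sz in ltv.
  move: vt vs; rewrite -vn !nth_wAB; try lia.
  by case=> _ vt [_ vs]; lia.
- apply/andP; split; apply/(has_nthP (gX, false)); rewrite sz.
    by exists 0%N; rewrite ?nth_wAB ?addn_gt0 ?l1_gt0 //= -ltnNge.
  by exists l1; rewrite ?nth_wAB /=; lia.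
Qed.

Lemma dihedral_gens_exist q : (2 <= q)%N ->
  exists g h : 'D_(4 * q), dihedral_gens q g h.
Proof.
move=> q_ge2; have -> : (4 * q = (2 * q).*2)%N by lia.
have q2_gt1 : (1 < 2 * q)%N by lia.
have := Grp'_dihedral q2_gt1 => /(_ _ [set: 'D_((2 * q).*2)]%G).
rewrite homg_refl => /esym /existsP[[g h]] /eqP[gen g2 h2 gh].
by exists g, h; split=> //; rewrite -gen joing_idl joing_idr.
Qed.

Section Group.
Variables (gT : finGroupType) (q : nat).
Hypothesis q_ge2 : (2 <= q)%N.
Hypothesis oG : #|gT| = (4 * q)%N.
Lemma gens_exp (g h : gT) : dihedral_gens q g h -> forall j,
  (g * (g * h) ^+ j = (g * h) ^- j * g)%g.
Proof.
case=> _ g2 h2 _; elim=> [|j IH]; first by rewrite mulg1 invg1 mul1g.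
have ggg : (g * (g * h) = (g * h)^-1 * g)%g.
  have gi : (g^-1 = g)%g by apply/eqP; rewrite eq_invg_mul -expg2 g2.
  have hi : (h^-1 = h)%g by apply/eqP; rewrite eq_invg_mul -expg2 h2.
  by rewrite invMg hi gi mulgA -expg2 g2 mul1g -mulgA -expg2 g2 mulg1.
move: (g * h)%g ggg IH => c gc IH.
by rewrite {1}expgS mulgA gc -mulgA IH mulgA -invMg -expgSr.
Qed.

Definition nf (g h : gT) (p : 'I_(2 * q) * bool) := ((g * h) ^+ p.1 * g ^+ p.2)%g.

Lemma nf_bij (g h : gT) : dihedral_gens q g h -> bijective (nf g h).
Proof.
move=> ghP; have gexp := gens_exp ghP; case: ghP => genG g2 h2 c1.
set c := (g * h)%g in gexp c1 *.
have q2 : (0 < 2 * q)%N by lia.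
have gi : (g^-1 = g)%g by apply/eqP; rewrite eq_invg_mul -expg2 g2.
have hi : (h^-1 = h)%g by apply/eqP; rewrite eq_invg_mul -expg2 h2.
have cD : #|{: 'I_(2 * q) * bool}| = #|{: gT}|.
  by rewrite card_prod card_ord card_bool oG; lia.
have nfE i (b : nat) : exists p, nf g h p = (c ^+ i * g ^+ b)%g.
  exists (Ordinal (ltn_pmod i q2), odd b); rewrite /nf /= -/c.
  rewrite -[in RHS](expg_mod _ c1) -[in RHS](expg_mod _ g2) modn2.
  by [].
have surj x : exists p, nf g h p = x.
  have : x \in <<[set g; h]>>%g by rewrite genG inE.
  case/gen_prodgP=> n [f fgh ->].
  elim: n f fgh => [|n IH] f fgh.
    by rewrite big_ord0; have [p pE] := nfE 0%N 0%N; exists p; rewrite pE mulg1.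
  rewrite big_ord_recr /=.
  have [[i b] <-] := IH (fun j => f (widen_ord (leqnSn n) j)) (fun j => fgh _).
  have := fgh ord_max; rewrite !inE => /orP[] /eqP -> {f fgh IH}; rewrite /nf /= -/c.
    by rewrite -mulgA -expgSr; apply: nfE.
  case: b => /=.
    have -> : (c ^+ i * g ^+ true * h = c ^+ i.+1 * g ^+ 0)%g.
      by rewrite mulg1 expg1 -mulgA expgSr.
    exact: nfE.
  have -> : (c ^+ i * g ^+ false * h = c ^+ (i + (2 * q).-1) * g ^+ 1)%g.
    rewrite mulg1 expgD -mulgA; congr (_ * _)%g.
    have ci : (c ^+ (2 * q).-1 = c^-1)%g.
      by apply/eqP; rewrite eq_sym eq_invg_mul -expgS prednK ?c1.
    by rewrite ci invMg hi gi expg1 -mulgA -expg2 g2 mulg1.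
  exact: nfE.
apply: inj_card_bij; last by rewrite cD.
suff inj : {in predT &, injective (nf g h)} by move=> x y; apply: inj.
apply/image_injP; apply/eqP; rewrite -[RHS]/#|{: _}| cD.
apply: eq_card => x; rewrite inE.
by have [p <-] := surj x; apply/imageP; exists p.
Qed.

Lemma nf_exists (g h : gT) : dihedral_gens q g h -> exists i : gT -> 'I_(2 * q) * bool,
  cancel i (nf g h) /\ cancel (nf g h) i.
Proof. by move/nf_bij=> [i nK Kn]; exists i. Qed.

Lemma nfE (g h : gT) (ghP : dihedral_gens q g h) (q2 : (0 < 2 * q)%N) i (b : nat) :
  nf g h (Ordinal (ltn_pmod i q2), odd b) = ((g * h) ^+ i * g ^+ b)%g.
Proof.
case: ghP => _ g2 _ c1; rewrite /nf /=.
by rewrite -[in RHS](expg_mod _ c1) -[in RHS](expg_mod _ g2) modn2.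
Qed.
End Group.

Section Existence.

Variables (gT : finGroupType) (k : fieldType) (q : nat).
Hypothesis char2 : 2%N \in [pchar k].
Hypothesis q_ge2 : (2 <= q)%N.
Hypothesis oG : #|gT| = (4 * q)%N.
Hypothesis q_pow : exists e, q = (2 ^ e)%N.

Lemma mx_char2 n (A : 'M[k]_n) : A + A = 0.
Proof.
by rewrite -mulr2n -scaler_nat (pcharf0 char2) scale0r.
Qed.

Lemma mx_frob n (A B : 'M[k]_n) e : A *m B = B *m A ->
  (A + B) ^+ (2 ^ e) = A ^+ (2 ^ e) + B ^+ (2 ^ e).
Proof.
move=> cAB; elim: e => [|e IH]; first by rewrite !expr1.
rewrite expnSr !exprM IH !expr2.
set A' := A ^+ _; set B' := B ^+ _.
have cAB' : A' * B' = B' * A' by apply: commrX; apply: commr_sym; apply: commrX.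
by rewrite mulrDl !mulrDr -cAB' addrA -(addrA (A' * A')) mx_char2 addr0.
Qed.

Lemma rep_exists n (g h : gT) (X Y : 'M[k]_n) :
    dihedral_gens q g h ->
    X * X = 0 -> Y * Y = 0 -> (X * Y) ^+ q + (Y * X) ^+ q = 0 ->
  exists rM : mx_representation k [set: gT]%G n,
    X = 1%:M + rM g /\ Y = 1%:M + rM h.
Proof.
move=> ghP X2 Y2 XYq; pose a : 'M[k]_n := 1 + X; pose b : 'M[k]_n := 1 + Y.
have sq (Z : 'M[k]_n) : Z * Z = 0 -> (1 + Z) * (1 + Z) = 1.
  by move=> Z2; rewrite mulrDl mul1r mulrDr mulr1 Z2 addr0 -addrA mx_char2 addr0.
have a2 : a * a = 1 by apply: sq.
have b2 : b * b = 1 by apply: sq.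
pose c := a * b; pose d := b * a.
have cd : c * d = 1 by rewrite /c /d mulrA -(mulrA a b b) b2 mulr1 a2.
have dc : d * c = 1 by rewrite /c /d mulrA -(mulrA b a a) a2 mulr1 b2.
have eqD : c + d = X * Y + Y * X.
  have -> : c = 1 + Y + X + X * Y by rewrite /c mulrDl !mulrDr !mul1r !mulr1 addrA.
  have -> : d = 1 + Y + X + Y * X.
    by rewrite /d mulrDl !mulrDr !mul1r !mulr1 addrA (addrAC 1).
  by rewrite addrACA mx_char2 add0r.
have c2q : c ^+ (2 * q) = 1.
  have [e qe] := q_pow.
  have cdq : c ^+ q + d ^+ q = 0.
    rewrite qe -mx_frob; last by rewrite -[LHS]/(c * d) cd -[RHS]/(d * c) dc.
    rewrite eqD mx_frob -?qe // -![_ *m _]/(_ * _).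
    by rewrite [LHS]mulrA -(mulrA X Y Y) Y2 [RHS]mulrA -(mulrA Y X X) X2 !mulr0 !mul0r.
  have -> : c ^+ (2 * q) = c ^+ q * d ^+ q.
    rewrite mul2n -addnn exprD; congr (_ * _).
    by rewrite -[LHS]addr0 -(mx_char2 (d ^+ q)) addrA cdq add0r.
  by rewrite -exprMn_comm ?cd ?expr1n // /GRing.comm cd dc.
have q2 : (0 < 2 * q)%N by lia.
have cdj j : d ^+ j * c ^+ j = 1.
  by rewrite -exprMn_comm ?dc ?expr1n // /GRing.comm cd dc.
have dj j : (j <= 2 * q)%N -> d ^+ j = c ^+ (2 * q - j).
  by move=> lej; rewrite -[LHS]mulr1 -c2q -{1}(subnKC lej) exprD mulrA cdj mul1r.
have acj j : a * c ^+ j = d ^+ j * a.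
  elim: j => [|j IH]; first by rewrite mulr1 mul1r.
  have ac : a * c = d * a by rewrite /c /d mulrA a2 -mulrA a2 mul1r mulr1.
  by rewrite {1}exprS mulrA ac -mulrA IH mulrA -exprS.
have gexp := gens_exp ghP; have [iv [ivK nfK]] := nf_exists q_ge2 oG ghP.
pose phi x : 'M[k]_n := c ^+ (iv x).1 * a ^+ (iv x).2.
have phiE i (e : nat) : phi ((g * h) ^+ i * g ^+ e)%g = c ^+ i * a ^+ e.
  rewrite /phi -(nfE ghP q2) nfK /= -[in RHS](expr_mod _ c2q).
  by rewrite -[in RHS](@expr_mod _ 2 a) ?expr2 // modn2.
have [_ g2 h2 C1] := ghP.
have phi_rep : mx_repr [set: gT]%G phi.
  split=> [|x y _ _]; first by have := phiE 0%N 0%N; rewrite !expg0 mulg1 => ->; rewrite mul1r.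
  rewrite -[x]ivK -[y]ivK; case: (iv x) (iv y) => [i e] [j f]; rewrite /nf /=.
  have ltj : (j <= 2 * q)%N by case: (j) => j' /= /ltnW.
  rewrite !phiE; case: e => /=; last first.
    by rewrite expg0 mulg1 mulgA -expgD phiE expr0 mulmxE mulr1 mulrA exprD.
  have -> : ((g * h) ^+ i * g ^+ 1 * ((g * h) ^+ j * g ^+ f) =
            (g * h) ^+ (i + (2 * q - j)) * g ^+ (1 + f))%g.
    rewrite expg1 -mulgA (mulgA g) gexp expgD.
    have -> : ((g * h) ^- j = (g * h) ^+ (2 * q - j))%g.
      by apply/eqP; rewrite eq_invg_mul -expgD subnKC // C1.
    by rewrite -!mulgA expgS.
  rewrite phiE exprD -dj // exprD mulmxE !expr1.
  by rewrite -!mulrA; congr (_ * _); rewrite !mulrA acj.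
exists (MxRepresentation phi_rep) => /=.
have -> : phi g = a.
  by have := phiE 0%N 1%N; rewrite expg0 mul1g expg1 => ->; rewrite mul1r.
have -> : phi h = b.
  have -> : h = ((g * h) ^+ (2 * q - 1) * g ^+ 1)%g.
    have -> : ((g * h) ^+ (2 * q - 1) = (g * h) ^- 1)%g.
      by apply/eqP; rewrite eq_sym eq_invg_mul -expgD subnKC // C1.
    by rewrite -gexp mulgA -expg2 g2 mul1g.
  by rewrite phiE -dj ?expr1 // /d -mulrA a2 mulr1.
by rewrite /a /b !addrA -[1%:M]/(1 : 'M[k]_n) !mx_char2 !add0r.
Qed.

End Existence.

Section Nilpotent.

Variables (k : fieldType) (n : nat) (ht : 'I_n -> nat).

Definition lowers t (P : 'M[k]_n) : Prop :=
  forall i j, P i j != 0 -> (ht j + t <= ht i)%N.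

Lemma lowersM s t (P Q : 'M[k]_n) :
  lowers s P -> lowers t Q -> lowers (s + t) (P * Q).
Proof.
move=> lP lQ i j; rewrite mxE => nz.
have [l /andP[Pl Ql]] : exists l, (P i l != 0) && (Q l j != 0).
  apply/existsP; apply: contraNT nz => /existsPn nz; apply/eqP; apply: big1 => l _.
  by apply/eqP; move: (nz l); rewrite mulf_eq0 negb_and !negbK.
by have := lP i l Pl; have := lQ l j Ql; lia.
Qed.

Lemma lowersX s (P : 'M[k]_n) e : lowers s P -> lowers (e * s) (P ^+ e).
Proof.
move=> lP; elim: e => [|e IH]; last by rewrite exprS mulSn; apply: lowersM.
by move=> i j; rewrite expr0 mxE; case: (i =P j) => [->|_]; rewrite ?addn0 ?eqxx.
Qed.

Lemma nilpotent_rel q (X Y : 'M[k]_n) : (forall i, ht i < 2 * q)%N ->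
  lowers 1 X -> lowers 1 Y -> (X * Y) ^+ q + (Y * X) ^+ q = 0.
Proof.
have low0 (P : 'M[k]_n) : (forall i, ht i < 2 * q)%N -> lowers (q * 2) P -> P = 0.
  move=> hlt lP; apply/matrixP=> i j; rewrite mxE; apply/eqP; apply/negPn/negP.
  by move/lP; have := hlt i; lia.
move=> hlt lX lY; have lXY := @lowersX 2 _ q (lowersM lX lY).
have lYX := @lowersX 2 _ q (lowersM lY lX).
by rewrite [X in X + _](low0 _ hlt lXY) [X in _ + X](low0 _ hlt lYX) addr0.
Qed.

Lemma square0 (P : 'M[k]_n) :
  (forall i j l, P i j != 0 -> P j l != 0 -> False) -> P * P = 0.
Proof.
move=> PP; apply/matrixP=> i j; rewrite !mxE; apply: big1 => l _.
apply/eqP; rewrite mulf_eq0; apply/negPn/negP; rewrite negb_or => /andP[].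
exact: PP.
Qed.

End Nilpotent.

Section ModuleExistence.

Variables (k : fieldType) (q : nat) (g h : 'D_(4 * q)).
Hypothesis char2 : 2%N \in [pchar k].
Hypothesis q_ge2 : (2 <= q)%N.
Hypothesis q_pow : exists e, q = (2 ^ e)%N.
Hypothesis ghP : dihedral_gens q g h.

Lemma module_exists n (M : gen -> 'M[k]_n) (ht : 'I_n -> nat) :
    (forall i, ht i < 2 * q)%N -> (forall Z, lowers ht 1 (M Z)) ->
    (forall Z i j l, M Z i j != 0 -> M Z j l != 0 -> False) ->
  exists rM, is_module_of g h M rM.
Proof.
move=> hlt low sq; apply: (rep_exists (q := q)) => //.
- have -> : (4 * q = (2 * q).*2)%N by lia.
  rewrite -cardsT.
  by rewrite card_dihedral; lia.
- exact/square0/sq.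
- exact/square0/sq.
- exact: nilpotent_rel hlt (low _) (low _).
Qed.

Lemma string_module_exists (w : word) : (size w < 2 * q)%N -> inW w ->
  all (fun a : letter => ~~ a.2) w ->
  exists rM, is_module_of g h (string_mx k w) rM.
Proof.
move=> ltw Ww dirw.
have nz Z i j : string_mx k w Z i j != 0 ->
  [/\ (i = j.+1 :> nat), wletter w i = (Z, false) & (0 < i)%N].
  rewrite mxE; case: ifP => [/andP[i_gt0 /eqP wi]|_].
    by case: (_ =P j.+1); rewrite ?eqxx.
  case: ifP => [/andP[lti /eqP wi]|_]; last by rewrite eqxx.
  by have := allP dirw _ (mem_nth (gX, false) lti); rewrite -/(wletter w i.+1) wi.
apply: (module_exists (ht := fun i => i)).
- by move=> i; apply: leq_trans ltw.
- by move=> Z i j /nz[-> _ _]; rewrite addn1.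
move=> Z i j l /nz[ij wi _] /nz[jl wj _].
have lti : (j < size w)%N by rewrite -ltnS -ij.
move: Ww => /(sortedP (gX, false)) /(_ l); rewrite -jl => /(_ lti).
by move: wi wj; rewrite ij jl /wletter => -> ->; rewrite eqxx.
Qed.

Lemma wA_module_exists l : (l < 2 * q)%N ->
  exists rM, is_module_of g h (string_mx k (wA l)) rM.
Proof.
have [sA _ nA] := wA_wB l.
move=> ltl; apply: string_module_exists; first by rewrite sA.
  apply/(sortedP (gX, false)) => i; rewrite sA => lti.
  have [-> _] := nA i (ltnW lti); have [-> _] := nA i.+1 lti.
  by rewrite /=; case: (odd i); case: (odd l).
apply/(all_nthP (gX, false)) => i; rewrite sA => lti.
by have [-> _] := nA i lti.
Qed.

Lemma wB_module_exists l : (l < 2 * q)%N ->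
  exists rM, is_module_of g h (string_mx k (wB l)) rM.
Proof.
have [_ sB nB] := wA_wB l.
move=> ltl; apply: string_module_exists; first by rewrite sB.
  apply/(sortedP (gX, false)) => i; rewrite sB => lti.
  have [_ ->] := nB i (ltnW lti); have [_ ->] := nB i.+1 lti.
  by rewrite /=; case: (odd i); case: (odd l).
apply/(all_nthP (gX, false)) => i; rewrite sB => lti.
by have [_ ->] := nB i lti.
Qed.

Lemma invmx_bandT n (rho : k) i j : (1 < n)%N -> rho != 0 ->
  invmx (bandT n rho) i j != 0 -> bandT n rho j i != 0.
Proof.
move=> n_gt1 rho0.
pose S : 'M[k]_n := \matrix_(i, j) (bandT n rho j i)^-1.
have pr (x : 'I_n) : ((if x == 0%N :> nat then n.-1 else x.-1) < n)%N.
  by have := ltn_ord x; case: ifP; lia.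
have TE x y : bandT n rho x y =
    if y == Ordinal (pr x) then (if x == 1%N :> nat then rho else 1) else 0.
  rewrite mxE -val_eqE /=; do 2?case: (altP (nat_of_ord x =P _)) => [->|_] //=.
  - by case: ifP.
  - by case: ifP.
have TS : bandT n rho *m S = 1%:M.
  apply/matrixP=> x y; rewrite [LHS]mxE [RHS]mxE (bigD1 (Ordinal (pr x))) //= big1.
    rewrite addr0 [S _ _]mxE !TE eqxx -[Ordinal (pr x) == _]val_eqE /=.
    have -> : ((if x == 0%N :> nat then n.-1 else x.-1) ==
               (if y == 0%N :> nat then n.-1 else y.-1))%N = (x == y).
      rewrite -val_eqE /=; have := ltn_ord x; have := ltn_ord y.
      by case: ifP; case: ifP; lia.
    case: (x =P y) => [->|_]; last by rewrite invr0 mulr0.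
    by rewrite mulfV //; case: ifP; rewrite ?oner_eq0.
  by move=> z zx; rewrite TE (negPf zx) mul0r.
have [uT _] := mulmx1_unit TS.
have -> : invmx (bandT n rho) = S by rewrite -[LHS]mulmx1 -TS mulKmx.
by rewrite [S _ _]mxE invr_eq0.
Qed.

Lemma band_module_exists l1 l2 (rho : k) :
    (0 < l1 < 2 * q)%N -> (0 < l2 < 2 * q)%N -> inWprime (wAB l1 l2) ->
    rho != 0 ->
  exists rM, is_module_of g h (band_mx (wAB l1 l2) rho) rM.
Proof.
move=> /andP[l1_gt0 l1q] /andP[l2_gt0 l2q] /wAB_Wprime par rho0.
have {}par := par l1_gt0 l2_gt0.
have sz := size_wAB l1 l2.
have szp : (size (wAB l1 l2)).-1 = (l1 + l2).-1 by rewrite sz.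
have sz_gt1 : (1 < size (wAB l1 l2))%N by rewrite sz; lia.
have T_nz i j : bandT (size (wAB l1 l2)) rho i j != 0 ->
    j = (if i == 0%N :> nat then (l1 + l2).-1 else i.-1) :> nat.
  have nzb (b : bool) : (b%:R : k) != 0 -> b by case: b; rewrite ?eqxx.
  rewrite mxE szp; case: ifP => [_ /nzb/eqP //|_].
  case: ifP => [/eqP -> | _ /nzb/eqP //].
  by case: ifP => [/eqP -> //|_]; rewrite eqxx.
have L i : (i <= l1 + l2)%N -> wletter (wAB l1 l2) i =
    (odd i == odd l1, (i == 0%N) || (l1 < i)%N).
  case: i => [|i] lei; rewrite /wletter nth_wAB ?sz //; try lia;
    by congr pair; lia.
have nz Z i j : band_mx (wAB l1 l2) rho Z i j != 0 ->
  [/\ (0 < i <= l1)%N, Z = (odd i == odd l1) & j = i.-1 :> nat] \/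
  [/\ (l1 <= i)%N, Z = (odd i != odd l1) &
    j = (if i.+1 == l1 + l2 then 0 else i.+1)%N :> nat].
  have lti := ltn_ord i; rewrite [X in (_ < X)%N]sz in lti.
  have ltj := ltn_ord j; rewrite [X in (_ < X)%N]sz in ltj.
  rewrite mxE !L ?(ltnW lti) //; case: (_ =P (Z, false)) => [[<- inv] /T_nz jE|_].
    left; move/negbT: inv; rewrite negb_or -leqNgt => /andP[i0 il].
    by rewrite (negPf i0) in jE; split=> //; rewrite lt0n i0.
  case: (_ =P (Z, true)) => [[<- inv]|_]; last by rewrite eqxx.
  move/(invmx_bandT sz_gt1 rho0)/T_nz => iE; right.
  split=> //; first by rewrite /=; case: (odd i); case: (odd l1).
  by move: iE; case: ifP; case: ifP; lia.
pose ht (i : 'I_(size (wAB l1 l2))) :=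
  (if i < l1 then i : nat else if i == l1 :> nat then maxn l1 l2
   else l1 + l2 - i)%N.
apply: (module_exists (ht := ht)).
- by move=> i; rewrite /ht; have := ltn_ord i; rewrite [X in (_ < X)%N]sz;
    do 2?case: ifP; lia.
- move=> Z i j; have := ltn_ord i; rewrite [X in (_ < X)%N]sz => lti.
  have := ltn_ord j; rewrite [X in (_ < X)%N]sz => ltj.
  rewrite /ht; case/nz=> [[]|[]].
    by move=> /andP[i0 il] _ ->; do !case: ifP; lia.
  by move=> li _ ->; do !case: ifP; lia.
move=> Z i j l; have := ltn_ord i; rewrite [X in (_ < X)%N]sz => lti.
by move=> /nz[[+ -> +]|[+ -> +]] /nz[[+ + +]|[+ + +]]; do ?case: ifP; lia.
Qed.

End ModuleExistence.

(* Main.v *)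
(** For a 2-group in characteristic 2, a module has a non-zero projective
    summand if and only if the sum of all group elements acts on it non-trivially.
    On a tensor product this sum is T = sum_x x (x) x.  The algebra of the
    dihedral group is symmetric, with a basis of alternating words in X and Y in
    which the word of length t starting with Z is dual, up to reversal, to the
    word of length 2q - t starting with the other letter.  Comparing the
    Casimir elements of the two symmetrizing forms gives
      sum_t (X_t (x) Y_(2q-t) + Y_(2q-t) (x) X_t) = T (1 (x) v)
    with v of augmentation 1, hence invertible, where X_t and Y_t are the words
    of length t starting with X and Y.  So T acts as zero exactly when the
    left-hand side does.  If L and L' are the largest lengths of words not
    killing the two factors, the left-hand side vanishes for L + L' < 2q, has a
    non-zero coefficient at length L - 1 for L + L' > 2q, and for L + L' = 2q
    reduces to X_L (x) Y_L' + Y_L (x) X_L', which has rank one or vanishes.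
    For bands with l1 = l2 one has Y_L = rho X_L, whence the factor rho + sigma. *)

Require Import Defs.
From HB Require Import structures.
From mathcomp Require Import all_boot all_order all_algebra all_fingroup.
From mathcomp Require Import all_solvable all_character.
From mathcomp Require Import zify.

Set Implicit Arguments.
Unset Strict Implicit.
Unset Printing Implicit Defensive.

Import GRing.Theory.
Local Open Scope ring_scope.

(** * Projective summands and the norm element *)

Section Norm.

Variables (k : fieldType) (gT : finGroupType) (G : {group gT}).
Local Notation nG := (gcard G).
Local Notation aG := (regular_repr k G).

Definition norm_mx n (rG : mx_representation k G n) : 'M[k]_n :=
  \sum_(x in G) rG x.

Lemma norm_mxr n (rG : mx_representation k G n) x :
  x \in G -> norm_mx rG *m rG x = norm_mx rG.
Proof.
move=> Gx; rewrite /norm_mx mulmx_suml.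
rewrite [RHS](reindex_inj (mulIg x)) /=.
by apply: eq_big => y; rewrite ?groupMr // => Gy; rewrite repr_mxM.
Qed.

Lemma norm_mx_hom m n (rU : mx_representation k G m)
    (rV : mx_representation k G n) f :
  mxhom rU rV f -> norm_mx rU *m f = f *m norm_mx rV.
Proof.
by move=> hom_f; rewrite mulmx_suml mulmx_sumr; apply: eq_bigr => x /hom_f.
Qed.

Lemma norm_mx_dadd (rU rV : representation k G) :
  norm_mx (dadd_grepr rU rV) = block_mx (norm_mx rU) 0 0 (norm_mx rV).
Proof.
have blockE (I : eqType) (s : seq I) (A : I -> 'M_(rdegree rU))
    (B : I -> 'M_(rdegree rV)) :
    \sum_(i <- s) block_mx (A i) 0 0 (B i)
    = block_mx (\sum_(i <- s) A i) 0 0 (\sum_(i <- s) B i).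
  elim: s => [|i s IH]; first by rewrite !big_nil block_mx0.
  by rewrite !big_cons IH add_block_mx !addr0.
by rewrite /norm_mx -!big_enum /= blockE.
Qed.

(** * Splitting off a retract *)

Section Split.

Variables (p n : nat) (rP : mx_representation k G p).
Variables (rM : mx_representation k G n) (f : 'M[k]_(p, n)) (r : 'M[k]_(n, p)).
Hypotheses (hom_f : mxhom rP rM f) (hom_r : mxhom rM rP r) (fr1 : f *m r = 1%:M).

(** As [f] followed by [r] is the identity of P, the module M is the direct sum of the image of [f]
    and the kernel of [r], and [r] maps that image isomorphically onto P. *)
Lemma retract_summand : exists rQ : representation k G,
  mx_rsim rM (dadd_grepr (Representation rP) rQ).
Proof.
have modU : mxmodule rM <<f>>%MS.
  apply/mxmoduleP=> x Gx; rewrite (eqmxMr _ (genmxE f)) genmxE -hom_f //.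
  exact: submxMl.
have modK : mxmodule rM (kermx r).
  apply/mxmoduleP=> x Gx; apply/sub_kermxP.
  by rewrite -mulmxA hom_r // mulmxA mulmx_ker mul0mx.
have mod1 := mxmodule1 rM.
exists (Representation (submod_repr modK)).
apply: (mx_rsim_trans (mx_rsim_sym (rsim_submod1 mod1 (eqmx_refl _)))).
have f_free : row_free f by apply/row_freeP; exists r.
have capfK m (W : 'M_(m, n)) : (W <= f)%MS -> W *m r = 0 -> W = 0.
  by move=> /submxP[D ->]; rewrite -mulmxA fr1 mulmx1 => ->; rewrite mul0mx.
apply: (mx_rsim_dadd (U := <<f>>%MS) (modU := modU) (modV := modK)).
- apply/eqmxP; rewrite submx1 /=.
  have -> : 1%:M = r *m f + (1%:M - r *m f) by rewrite addrC subrK.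
  apply: addmx_sub_adds; first by rewrite genmxE submxMl.
  by apply/sub_kermxP; rewrite mulmxBl mul1mx -mulmxA fr1 mulmx1 subrr.
- apply/mxdirect_addsP/capfK.
    by rewrite (submx_trans (capmxSl _ _)) ?genmxE.
  by apply/sub_kermxP; apply: capmxSr.
- have freeB : row_free (val_submod (1%:M : 'M_(\rank <<f>>)) *m r).
    rewrite -kermx_eq0; apply/eqP.
    apply: val_submod_inj; rewrite linear0.
    apply: capfK; first by rewrite (submx_trans (val_submodP _)) ?genmxE.
    by rewrite val_submodE -mulmxA mulmx_ker.
  exists (val_submod 1%:M *m r) => //.
    by rewrite genmxE (eqP f_free).
  move=> x Gx; rewrite /= mulmxA -val_submodE -[submod_mx _ x]mul1mx.
  by rewrite val_submodJ // -!mulmxA hom_r.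
- exact: mx_rsim_refl.
Qed.

End Split.

(** * Homomorphisms from and to the regular module *)

Lemma regular_mxE x i j : aG x i j = (j == gring_index G (enum_val i * x))%:R.
Proof. by rewrite !mxE eqxx. Qed.

Definition orbit_mx n (rM : mx_representation k G n) (v : 'rV[k]_n) :
    'M[k]_(nG, n) :=
  \matrix_i (v *m rM (enum_val i)).

Lemma orbit_mx_hom n (rM : mx_representation k G n) v :
  mxhom aG rM (orbit_mx rM v).
Proof.
move=> x Gx; apply/row_matrixP=> i; rewrite !row_mul !rowK -rowE rowK.
by rewrite -mulmxA -repr_mxM ?enum_valP // gring_indexK // groupM ?enum_valP.
Qed.

Lemma regular_hom_eq n (rM : mx_representation k G n) (f h : 'M_(nG, n)) :
  mxhom aG rM f -> mxhom aG rM h ->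
  row (gring_index G 1) f = row (gring_index G 1) h -> f = h.
Proof.
move=> hom_f hom_h fh1; apply/row_matrixP=> i.
have ei : delta_mx 0 i = delta_mx 0 (gring_index G 1) *m aG (enum_val i) :> 'rV[k]__.
  by rewrite -rowE rowK gring_indexK // mul1g gring_valK.
rewrite !rowE ei -!mulmxA hom_f ?hom_h ?enum_valP //.
by rewrite !mulmxA -!rowE fh1.
Qed.

(** The regular module is free on the identity: lifting the image of 1 through [p] determines the
    lift of [f]. *)
Lemma regular_projective : mxprojective aG.
Proof.
move=> u v rU rV p f hom_p full_p hom_f.
pose w := row (gring_index G 1) f *m pinvmx p.
exists (orbit_mx rU w); first exact: orbit_mx_hom.
apply: (regular_hom_eq (rM := rV)) => //.
  move=> x Gx. by rewrite mulmxA orbit_mx_hom // -!mulmxA hom_p.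
rewrite row_mul rowK gring_indexK // repr_mx1 mulmx1 mulmxKpV //.
exact: submx_full.
Qed.

(* The homomorphism m |-> sum_x l(m x^-1) x to the regular module. *)
Definition coorbit_mx n (rM : mx_representation k G n) (l : 'cV[k]_n) :
    'M[k]_(n, nG) :=
  \matrix_(i, j) (rM (enum_val j)^-1%g *m l) i 0.

Lemma coorbit_mx_hom n (rM : mx_representation k G n) l :
  mxhom rM aG (coorbit_mx rM l).
Proof.
move=> x Gx; apply/matrixP=> i j.
have Gj : (enum_val j * x^-1)%g \in G by rewrite groupM ?groupV ?enum_valP.
rewrite mxE [RHS]mxE (bigD1 (gring_index G (enum_val j * x^-1))) //=.
rewrite [in RHS]big1 => [|h neq_h]; last first.
  rewrite regular_mxE; case: eqP => [jE|_]; last by rewrite mulr0.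
  by case/eqP: neq_h; rewrite jE gring_indexK ?groupM ?enum_valP // mulgK gring_valK.
rewrite mxE gring_indexK // invMg invgK repr_mxM ?groupV ?enum_valP //.
rewrite regular_mxE gring_indexK // mulgKV gring_valK eqxx mulr1 addr0.
by rewrite -mulmxA mxE; apply: eq_bigr => y _; rewrite mxE.
Qed.

(** * Modules of p-groups in characteristic p *)

Variable p : nat.
Hypotheses (p_char : p \in [pchar k]) (pG : (p.-group G)%g).

Lemma pgroup_fixed_row m n (rM : mx_representation k G n) (U : 'M[k]_(m, n)) :
  mxmodule rM U -> U != 0 ->
  exists v : 'rV_n, [/\ v != 0, (v <= U)%MS & forall x, x \in G -> v *m rM x = v].
Proof.
move=> modU nzU.
have modgU : mxmodule rM <<U>>%MS by rewrite (eqmx_module _ (genmxE U)).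
have := rfix_pgroup_pchar p_char (submod_repr modgU) _ pG (subxx _).
rewrite lt0n mxrank_eq0 -submx0 genmxE submx0 => /(_ nzU).
case/rowV0Pn=> w /rfix_mxP fix_w nzw; exists (val_submod w); split.
- by apply: contraNneq nzw => w0; apply/eqP/val_submod_inj; rewrite w0 linear0.
- by rewrite (submx_trans (val_submodP _)) ?genmxE.
by move=> x Gx; rewrite -val_submodJ // fix_w.
Qed.

(** From a non-zero entry (i, j) of the norm, the orbit map of e_i followed by the coorbit map of
    the rescaled j-th coordinate is an endomorphism of kG fixing the norm element. The fixed vectors
    of kG are the multiples of that element, so the kernel, a submodule without non-zero fixed
    vectors, vanishes, and kG is a retract of M. *)
Lemma regular_summand n (rM : mx_representation k G n) :
  norm_mx rM != 0 -> has_proj_summand rM.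
Proof.
case/matrix0Pn=> [i [j nzN]].
pose v : 'rV[k]_n := delta_mx 0 i.
pose l : 'cV[k]_n := (norm_mx rM i j)^-1 *: delta_mx j 0.
pose f := orbit_mx rM v; pose c := coorbit_mx rM l.
have hom_f : mxhom aG rM f := orbit_mx_hom rM v.
have hom_c : mxhom rM aG c := coorbit_mx_hom rM l.
have hom_fc : mxhom aG aG (f *m c).
  by move=> x Gx; rewrite mulmxA hom_f // -!mulmxA hom_c.
pose one := const_mx 1 : 'rV[k]_nG.
have u_fc : f *m c \in unitmx.
  rewrite -row_free_unit -kermx_eq0; apply: contraT => nzK.
  have modK : mxmodule aG (kermx (f *m c)).
    apply/mxmoduleP=> x Gx; apply/sub_kermxP.
    by rewrite -mulmxA hom_fc // mulmxA mulmx_ker mul0mx.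
  have [w [nzw /sub_kermxP wK fix_w]] := pgroup_fixed_row modK nzK.
  have [a wE] : exists a : 'rV_1, w = a *m gring_row (gset_mx k G G).
    by apply/submxP; rewrite -rfix_regular; apply/rfix_mxP.
  have normE : gring_row (gset_mx k G G) *m (f *m c) = const_mx 1.
    rewrite -gring_row_mul -[gset_mx _ _ _]/(norm_mx aG) (norm_mx_hom hom_fc).
    rewrite /gring_row !row_mul rowK gring_indexK // repr_mx1 mulmx1 -mulmxA.
    rewrite -(norm_mx_hom hom_c) mulmxA.
    apply/rowP=> s; rewrite !mxE.
    rewrite (eq_bigr (fun t => norm_mx rM i t * (rM (enum_val s)^-1%g *m l) t 0)).
      have := norm_mxr rM (groupVr (enum_valP s)).
      move/(congr1 (fun A => (A *m l) i 0)); rewrite -mulmxA !mxE => ->.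
      rewrite (bigD1 j) //= big1 ?addr0; first by rewrite !mxE !eqxx mulr1 mulfV.
      by move=> t /negPf tj; rewrite !mxE tj !mulr0.
    by move=> t _; rewrite -rowE !mxE.
  move: nzw; rewrite wE; have := wK; rewrite wE -mulmxA normE.
  move/rowP/(_ (gring_index G 1)); rewrite !mxE big_ord1 !mxE mulr1 => a0.
  have -> : a = 0 by apply/matrixP=> x y; rewrite !ord1 a0 mxE.
  by rewrite mul0mx eqxx.
have hom_r : mxhom rM aG (c *m invmx (f *m c)).
  move=> x Gx; rewrite mulmxA hom_c // -!mulmxA; congr (_ *m _).
  apply: (canRL (mulKmx u_fc)).
  by rewrite mulmxA -hom_fc // mulmxK.
have [|rQ simM] := retract_summand hom_f hom_r; first by rewrite mulmxA mulmxV.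
exists (Representation aG), rQ; split=> //; last exact: regular_projective.
exact: cardG_gt0.
Qed.

(* The diagonal action on kG (x) P, encoded as matrices with rows indexed by G;
   augmenting kG maps this module onto P. *)
Definition cover_act n (rP : mx_representation k G n) x (A : 'M[k]_(nG, n)) :=
  (aG x)^T *m A *m rP x.

Fact cover_act_is_linear n (rP : mx_representation k G n) x :
  linear (cover_act rP x).
Proof. by move=> a A B; rewrite /cover_act mulmxDr mulmxDl -scalemxAr -scalemxAl. Qed.

HB.instance Definition _ n (rP : mx_representation k G n) x :=
  GRing.isSemilinear.Build _ _ _ _ (cover_act rP x)
    (GRing.semilinear_linear (cover_act_is_linear rP x)).

Definition cover_mx n (rP : mx_representation k G n) x := lin_mx (cover_act rP x).

(** Projectivity splits the augmentation onto P. The splitting sends a non-zero fixed vector v to an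
    invariant array whose row at x is ux, with u its row at 1. Summing the rows gives v = uN for the
    norm N. *)
Lemma projective_norm n (rP : mx_representation k G n) :
  (0 < n)%N -> mxprojective rP -> norm_mx rP != 0.
Proof.
move=> n_gt0 projP.
have cover_repr : mx_repr G (cover_mx rP).
  split=> [|x y Gx Gy]; apply/row_matrixP=> i.
    rewrite rowE mul_rV_lin /= /cover_act !repr_mx1 trmx1 mul1mx mulmx1 vec_mxK.
    by rewrite rowE mulmx1.
  rewrite row_mul !rowE !mul_rV_lin /= /cover_act mxvecK !repr_mxM //.
  by rewrite trmx_mul !mulmxA.
pose rU := MxRepresentation cover_repr.
pose aug : 'M_(nG * n, n) := lin1_mx (mulmx (const_mx 1 : 'rV[k]_nG) \o vec_mx).
have augE (w : 'rV_(nG * n)) : w *m aug = const_mx 1 *m vec_mx w.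
  by rewrite mul_rV_lin1.
have hom_aug : mxhom rU rP aug.
  move=> x Gx; apply/row_matrixP=> i; rewrite !row_mul !rowE !augE mul_rV_lin /=.
  rewrite /cover_act mxvecK.
  rewrite !mulmxA; congr (_ *m _ *m _).
  apply/rowP=> h; rewrite !mxE (bigD1 (gring_index G (enum_val h * x))) //=.
  rewrite [_^T _ _]mxE regular_mxE eqxx mxE mulr1 big1 ?addr0 // => t /negPf neq_t.
  by rewrite [_^T _ _]mxE regular_mxE neq_t mulr0.
have full_aug : row_full aug.
  apply/row_fullP; exists (lin1_mx (mxvec \o mulmx (delta_mx (gring_index G 1) 0))).
  apply/row_matrixP=> i; rewrite row_mul rowE augE mul_rV_lin1 /= mxvecK mulmxA.
  rewrite row1; set d := const_mx 1 *m _; have -> : d = 1%:M; last by rewrite mul1mx.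
  rewrite [d]mx11_scalar; congr _%:M; rewrite !mxE (bigD1 (gring_index G 1)) //=.
  rewrite !mxE !eqxx mulr1 big1 ?addr0 // => j /negPf neq_j.
  by rewrite !mxE neq_j mulr0.
have [s hom_s sp1] := projP _ _ _ _ _ 1%:M hom_aug full_aug
  (fun x _ => etrans (mulmx1 _) (esym (mul1mx _))).
have [|v [nzv _ fix_v]] := pgroup_fixed_row (mxmodule1 rP).
  by rewrite -mxrank_eq0 mxrank1 -lt0n.
pose S := vec_mx (v *m s).
(* Row x of S is the component of the lift of v at x. *)
have rowS x : x \in G -> row (gring_index G x) S = row (gring_index G 1) S *m rP x.
  move=> Gx; have SE : S = cover_act rP x S.
    rewrite {1}/S -(fix_v x Gx) -mulmxA hom_s // mulmxA.
    by rewrite mul_rV_lin mxvecK.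
  have -> : row (gring_index G x) S = row (gring_index G x) (aG x)^T *m S *m rP x.
    by rewrite {1}SE /cover_act !row_mul.
  rewrite [in RHS]rowE; congr (_ *m _ *m _).
  apply/rowP=> h; rewrite [LHS]mxE [LHS]mxE regular_mxE.
  rewrite !mxE eqxx -(can_eq (@gring_valK _ G)) !gring_indexK ?groupM ?enum_valP //.
  rewrite (eq_sym x) -(inj_eq (mulIg x^-1%g)) mulgK mulgV.
  by rewrite -(can_in_eq (@gring_indexK _ G)) ?enum_valP // gring_valK.
have vE : v = row (gring_index G 1) S *m norm_mx rP.
  rewrite mulmx_sumr -[LHS]mulmx1 -sp1 mulmxA augE -/S mulmx_sum_row.
  rewrite [RHS]big_enum_val /=; apply: eq_bigr => i _.
  by rewrite mxE scale1r -rowS ?enum_valP // gring_valK.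
by apply: contraNneq nzv => N0; rewrite vE N0 mulmx0.
Qed.

Lemma has_proj_summandP n (rM : mx_representation k G n) :
  has_proj_summand rM <-> norm_mx rM != 0.
Proof.
split; last exact: regular_summand.
case=> rP [rQ [P_gt0 projP]]; case/mx_rsim_sym=> B _ freeB hom_B.
apply: contraNneq (projective_norm P_gt0 projP) => N0.
have := norm_mx_hom hom_B; rewrite N0 mulmx0 norm_mx_dadd => /eqP.
rewrite mulmx_free_eq0 // -block_mx0 => /eqP/eq_block_mx[-> _ _ _].
by [].
Qed.

End Norm.

(** * The Casimir element of the dihedral group algebra *)

Section AlternatingWords.

Variables (k : fieldType) (n : nat).
Implicit Types (M : gen -> 'M[k]_n) (Z : gen).

(* The matrices act on rows, so the letter Z is the first one applied. *)
Fixpoint altop M Z t : 'M[k]_n :=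
  if t is t'.+1 then M Z *m altop M (~~ Z) t' else 1%:M.

Lemma altop_add M Z s t :
  altop M Z (s + t) = altop M Z s *m altop M (odd s (+) Z) t.
Proof.
elim: s Z => [|s IH] Z; first by rewrite mul1mx.
by rewrite addSn /= IH mulmxA; case: (odd s); case: Z.
Qed.

Lemma altop_eq0 M Z s t : (s <= t)%N -> altop M Z s = 0 -> altop M Z t = 0.
Proof. by move=> /subnK <- M0; rewrite addnC altop_add M0 mul0mx. Qed.

Lemma altop_double M Z j : altop M Z (2 * j) = (M Z * M (~~ Z)) ^+ j.
Proof.
elim: j => [|j IH]; first by [].
by rewrite mulnS altop_add /= mulmx1 IH exprS.
Qed.

End AlternatingWords.

(** * Alternating products of involutions in characteristic 2 *)

Section Char2.

Variable R : pzRingType.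
Hypothesis R2 : forall x : R, x + x = 0.

(** By Frobenius, passing from e to e + 1 multiplies both sides by 1 + y^(2^e). *)
Lemma geometric_char2 (y : R) e : (1 + y) ^+ (2 ^ e).-1 = \sum_(i < 2 ^ e) y ^+ i.
Proof.
have Frob j : (1 + y) ^+ (2 ^ j) = 1 + y ^+ (2 ^ j).
  elim: j => [|j IH]; first by rewrite !expr1.
  rewrite expnSr !exprM IH expr2 mulrDl mul1r mulrDr mulr1 addrA -(addrA 1).
  by rewrite R2 addr0 expr2.
elim: e => [|e IH]; first by rewrite expr0 big_ord1.
have -> : (2 ^ e.+1 = 2 ^ e + 2 ^ e)%N by rewrite expnS; lia.
have -> : ((2 ^ e + 2 ^ e).-1 = (2 ^ e).-1 + 2 ^ e)%N.
  by have := expn_gt0 2 e; lia.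
rewrite exprD IH Frob mulrDr mulr1 big_split_ord /=; congr (_ + _).
by rewrite mulr_suml; apply: eq_bigr => i _; rewrite addnC exprD.
Qed.

(** With d = ss' and d' = s's, the relations d(1+s') = s(1+s') and (1+s')^2 = 0 give
    (1+s')(1+s)(1+s') = (d+d')(1+s'). *)
Lemma dihedral_word (s s' : R) j : s * s = 1 -> s' * s' = 1 ->
  ((1 + s) * (1 + s')) ^+ j.+1 =
  (1 + s * s') * (s * s' + s' * s) ^+ j * (1 + s').
Proof.
move=> s2 s'2; pose d := s * s'; pose d' := s' * s.
have ds' : d * (1 + s') = s * (1 + s').
  by rewrite /d !mulrDr !mulr1 -mulrA s'2 mulr1 addrC.
have s's' : (1 + s') * (1 + s') = 0.
  by rewrite mulrDl mul1r mulrDr mulr1 s'2 (addrC s') R2.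
have first_step : (1 + s) * (1 + s') = (1 + d) * (1 + s').
  by rewrite mulrDl [RHS]mulrDl ds'.
have step : (1 + s') * ((1 + s) * (1 + s')) = (d + d') * (1 + s').
  have -> : (1 + s') * ((1 + s) * (1 + s')) = ((1 + s') + (s + d')) * (1 + s').
    by rewrite mulrA; congr (_ * _); rewrite mulrDr mulr1 [(1 + s') * s]mulrDl mul1r.
  by rewrite mulrDl s's' add0r mulrDl [RHS]mulrDl ds'.
elim: j => [|j IH]; first by rewrite !expr1 expr0 mulr1 first_step.
by rewrite exprSr IH -!mulrA step -/d -/d' exprSr !mulrA.
Qed.

(** Put q = 2^e. In [dihedral_word], (d+d')^(q-1) = d'^(q-1) (1+d^2)^(q-1), and the last factor is
    the sum of the even powers of d. The factor 1+d completes it to the sum of all rotations, which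
    absorbs d'^(q-1). *)
Lemma dihedral_word_pow (s s' : R) e : s * s = 1 -> s' * s' = 1 ->
    (s * s') ^+ (2 * 2 ^ e) = 1 ->
  ((1 + s) * (1 + s')) ^+ (2 ^ e) =
  (\sum_(i < 2 * 2 ^ e) (s * s') ^+ i) * (1 + s').
Proof.
move=> s2 s'2; set d := s * s' => dq; pose d' := s' * s; set N := \sum_(i < _) _.
have dd' : d * d' = 1 by rewrite /d /d' mulrA -(mulrA s) s'2 mulr1 s2.
have d'd : d' * d = 1 by rewrite /d /d' mulrA -(mulrA s') s2 mulr1 s'2.
have dN : d * N = N.
  rewrite /N; have: (0 < 2 * 2 ^ e)%N by rewrite muln_gt0 expn_gt0.
  case: (2 * 2 ^ e)%N dq => // j dq _.
  rewrite mulr_sumr big_ord_recr big_ord_recl /= -exprS dq expr0 addrC.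
  by congr (_ + _); apply: eq_bigr => i _; rewrite -exprS.
have d'N j : d' ^+ j * N = N.
  elim: j => [|j IH]; first by rewrite mul1r.
  by rewrite exprSr -mulrA -{1}dN (mulrA d') d'd mul1r.
have q_gt0 : (0 < 2 ^ e)%N by rewrite expn_gt0.
rewrite -{1}(prednK q_gt0) dihedral_word // -/d -/d'; congr (_ * _).
have -> : d + d' = d' * (1 + d ^+ 2) by rewrite mulrDr mulr1 expr2 mulrA d'd mul1r addrC.
have cd'd : GRing.comm d' d by rewrite /GRing.comm d'd dd'.
have cd' : GRing.comm d' (1 + d ^+ 2) by apply: commrD; [apply: commr1 | apply: commrX].
rewrite exprMn_comm // geometric_char2 mulrA.
have -> : (1 + d) * d' ^+ (2 ^ e).-1 = d' ^+ (2 ^ e).-1 * (1 + d).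
  by apply/commr_sym/commrD; [apply: commr1 | apply/commr_sym/commrX/commr_sym].
rewrite -mulrA -[RHS](d'N (2 ^ e).-1); congr (_ * _).
rewrite /N mul2n; elim: (2 ^ e)%N => [|j IH]; first by rewrite !big_ord0 mulr0.
by rewrite doubleS !big_ord_recr /= -IH mulrDr -addrA; congr (_ + _);
  rewrite mulrDl mul1r -exprM mul2n -exprS.
Qed.

End Char2.

Definition gpt (gT : Type) (g h : gT) (Z : gen) : gT := if Z then h else g.

Lemma dihedral_gens_sym (gT : finGroupType) q (g h : gT) Z :
  dihedral_gens q g h -> dihedral_gens q (gpt g h Z) (gpt g h (~~ Z)).
Proof.
case: Z => //= -[genG g2 h2 gh]; split=> //; first by rewrite setUC.
have gi : (g^-1 = g)%g by apply/eqP; rewrite eq_invg_mul -expg2 g2.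
have hi : (h^-1 = h)%g by apply/eqP; rewrite eq_invg_mul -expg2 h2.
by rewrite -{1}gi -{1}hi -invMg expgVn gh invg1.
Qed.

(** * Alternating words in the group algebra *)

Section NormWord.

Variables (k : fieldType) (gT : finGroupType) (q : nat) (g h : gT).
Hypotheses (char2 : 2%N \in [pchar k]) (q_ge2 : (2 <= q)%N).
Hypotheses (q_pow : exists e, q = (2 ^ e)%N) (oG : #|gT| = (4 * q)%N).
Hypothesis ghP : dihedral_gens q g h.
Local Notation reprG := (mx_representation k [set: gT]).
Local Notation s := (gpt g h).

Lemma pgroup_card4q : (2.-group [set: gT])%g.
Proof.
have [e qE] := q_pow; rewrite /pgroup cardsT oG qE -(expnD 2 2).
by rewrite pnatX pnat_id.
Qed.

Lemma gpt2 Z : (s Z * s Z = 1)%g.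
Proof. by case: ghP => _ g2 h2 _; case: Z; rewrite -expg2. Qed.

Lemma norm_altop n (rM : reprG n) (M : gen -> 'M_n) Z :
  (forall Z, M Z = 1%:M + rM (s Z)) -> altop M Z (2 * q) = norm_mx rM.
Proof.
move=> ME; have sP := dihedral_gens_sym Z ghP.
have r2 Z' : rM (s Z') * rM (s Z') = 1.
  by rewrite -[LHS]repr_mxM ?inE // gpt2 repr_mx1.
have rX x i : rM (x ^+ i)%g = rM x ^+ i.
  elim: i => [|i IH]; first by rewrite repr_mx1.
  by rewrite expgS exprS repr_mxM ?inE // IH.
have [e qE] := q_pow.
rewrite altop_double !ME qE dihedral_word_pow //; last first.
- rewrite -[rM _ * _]repr_mxM ?inE // -rX -qE; case: sP => _ _ _ ->.
  exact: repr_mx1.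
- exact: mx_char2.
rewrite -[rM _ * _]repr_mxM ?inE // -qE.
have bij_nf := nf_bij q_ge2 oG sP.
rewrite /norm_mx (reindex (@nf gT q (s Z) (s (~~ Z)))) /=; last exact: onW_bij.
transitivity (\sum_i \sum_b rM (@nf gT q (s Z) (s (~~ Z)) (i, b))); last first.
  by rewrite pair_bigA; apply: eq_big => [p|[i b] _ //]; rewrite inE.
under [RHS]eq_bigr do rewrite big_bool /nf /= expg0 mulg1 expg1 addrC.
rewrite big_split /= mulrDr mulr1 mulr_suml; congr (_ + _).
  by apply: eq_bigr => i _; rewrite rX.
under [LHS]eq_bigr do rewrite -rX -[_ * _]repr_mxM ?inE //.
(* With c = [s Z * s (~~ Z)], the reflections appear as c^i [s (~~ Z)] in the word but as c^i [s Z]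
   in [nf]; the two lists differ by a cyclic shift. *)
have shift i : ((s Z * s (~~ Z)) ^+ i.+1 * s (~~ Z) =
                (s Z * s (~~ Z)) ^+ i * s Z)%g.
  by rewrite expgSr -!mulgA gpt2 mulg1.
case: sP => _ _ _; case: (2 * q)%N => [|j] cq; first by rewrite !big_ord0.
rewrite big_ord_recl big_ord_recr /= addrC; congr (_ + _).
  by rewrite -shift cq expg0.
by apply: eq_bigr => i _; rewrite shift.
Qed.

(** The coefficient of x in the word of length t starting with Z, read in the group algebra; the
    recursion expands the first factor 1 + [s Z]. *)
Fixpoint altcoef Z t (x : gT) : k :=
  if t is t'.+1 then altcoef (~~ Z) t' x + altcoef (~~ Z) t' (s Z * x)%g
  else (x == 1%g)%:R.

Lemma altopE n (rM : reprG n) (M : gen -> 'M_n) Z t :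
  (forall Z, M Z = 1%:M + rM (s Z)) ->
  altop M Z t = \sum_x altcoef Z t x *: rM x.
Proof.
move=> ME; elim: t Z => [|t IH] Z /=.
  rewrite (bigD1 1%g) //= eqxx scale1r repr_mx1 big1 ?addr0 // => x /negPf ->.
  by rewrite scale0r.
rewrite IH ME mulmxDl mul1mx.
under [RHS]eq_bigr do rewrite scalerDl.
rewrite big_split; congr (_ + _) => /=.
rewrite [RHS](reindex_inj (mulgI (s Z))) mulmx_sumr; apply: eq_bigr => x _.
by rewrite mulgA gpt2 mul1g repr_mxM ?inE // scalemxAr.
Qed.

Lemma altcoef_fix Z t x :
  (0 < t)%N -> altcoef Z t (s Z * x)%g = altcoef Z t x.
Proof. by case: t => //= t _; rewrite mulgA gpt2 mul1g addrC. Qed.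

Lemma addrr_char2 (a : k) : a + a = 0.
Proof. by rewrite -mulr2n -mulr_natl (pcharf0 char2) mul0r. Qed.

Lemma altcoef_move Z t x :
  altcoef Z t (s (~~ Z) * x)%g = altcoef Z t x + altcoef (~~ Z) t.+1 x.
Proof. by rewrite /= negbK addrA addrr_char2 add0r. Qed.

Lemma altcoef_sum Z t : \sum_x altcoef Z t x = (t == 0%N)%:R.
Proof.
elim: t Z => [|t IH] Z /=.
  by rewrite (bigD1 1%g) //= eqxx big1 ?addr0 // => x /negPf ->.
rewrite big_split /= [X in _ + X](reindex_inj (mulgI (s Z))) /=.
under [X in _ + X]eq_bigr do rewrite mulgA gpt2 mul1g.
by rewrite addrr_char2.
Qed.

(** By [norm_altop] this word is the sum of all group elements; coefficients are compared in the
    regular representation. *)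
Lemma altcoef_top Z x : altcoef Z (2 * q) x = 1.
Proof.
pose aG := regular_repr k [set: gT].
have := norm_altop (rM := aG) (M := fun Z => 1%:M + aG (s Z)) Z (fun=> erefl).
rewrite (@altopE _ aG) // => /(congr1 (gring_proj x)).
rewrite !linear_sum /= => /rowP/(_ 0); rewrite !summxE.
rewrite (bigD1 x) //= big1 ?addr0 => [|y /negPf yx]; last first.
  by rewrite linearZ /= gring_projE ?inE // eq_sym yx scaler0 mxE.
rewrite (bigD1 x) ?inE //= big1 ?addr0 => [|y /andP[_ /negPf yx]]; last first.
  by rewrite gring_projE ?inE // eq_sym yx mxE.
by rewrite linearZ /= gring_projE ?inE // eqxx !mxE mulr1.
Qed.

(* Coefficient at x (x) y of the Casimir element built from alternating words;
   both words of length 0 are the identity and both of length 2q are the norm,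
   so the two choices of Z give the same element. *)
Definition theta Z x y : k :=
  \sum_(t < 2 * q) (altcoef (~~ Z) (2 * q - t) x * altcoef Z t y +
                    altcoef Z t x * altcoef (~~ Z) (2 * q - t) y).

(** Reversing the summation turns one side into the same summands taken over 1..2q instead of
    0..2q-1, and the summands at 0 and 2q agree. *)
Lemma theta_flip Z x y : theta (~~ Z) x y = theta Z x y.
Proof.
pose F t := altcoef (~~ Z) (2 * q - t) x * altcoef Z t y +
            altcoef Z t x * altcoef (~~ Z) (2 * q - t) y.
have q2 : (0 < 2 * q)%N by lia.
have -> : theta (~~ Z) x y = \sum_(t < 2 * q) F t.+1.
  rewrite /theta (reindex_inj rev_ord_inj) /=; apply: eq_bigr => t _.
  have -> : (2 * q - (2 * q - t.+1) = t.+1)%N by have := ltn_ord t; lia.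
  by rewrite negbK addrC.
have F0 : F 0%N = F (2 * q)%N.
  rewrite /F subn0 subnn !altcoef_top /= !mul1r !mulr1.
  exact: addrC.
rewrite /theta -/(F _).
have rot (f : nat -> k) j : (0 < j)%N -> f 0%N = f j ->
    \sum_(t < j) f t.+1 = \sum_(t < j) f t.
  by case: j => // j _ f0; rewrite big_ord_recr big_ord_recl /= f0 addrC.
exact: rot.
Qed.

(** The generator fixes words starting with its own letter and adds to any other word its extension
    by that letter. The extra terms cancel in pairs under reversal of the summation. *)
Lemma theta_step Z x y : theta Z (s (~~ Z) * x)%g (s (~~ Z) * y)%g = theta Z x y.
Proof.
pose F t := altcoef (~~ Z) (2 * q - t) x * altcoef (~~ Z) t.+1 y.
pose F' t := altcoef (~~ Z) t.+1 x * altcoef (~~ Z) (2 * q - t) y.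
have FF' : \sum_(t < 2 * q) F t = \sum_(t < 2 * q) F' t.
  rewrite (reindex_inj rev_ord_inj) /=; apply: eq_bigr => t _; rewrite /F /F'.
  have -> : (2 * q - (2 * q - t.+1) = t.+1)%N by have := ltn_ord t; lia.
  by rewrite subnSK.
transitivity (theta Z x y + (\sum_(t < 2 * q) F t + \sum_(t < 2 * q) F' t)).
  rewrite -!big_split; apply: eq_bigr => t _ /=; rewrite !altcoef_move.
  rewrite !altcoef_fix ?subn_gt0 //.
  by rewrite mulrDr mulrDl addrACA.
by rewrite FF' addrr_char2 addr0.
Qed.

Lemma theta_inv Z z x y : theta Z (z * x)%g (z * y)%g = theta Z x y.
Proof.
have step Z' a b : theta Z (s Z' * a)%g (s Z' * b)%g = theta Z a b.
  have [->|->] : Z' = ~~ Z \/ Z' = ~~ ~~ Z by case: Z'; case: Z; auto.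
    exact: theta_step.
  by rewrite -!(theta_flip Z) theta_step.
have : z \in <<[set g; h]>>%g by case: ghP => ->; rewrite inE.
case/gen_prodgP=> j [f fgh ->] {z}; elim: j f fgh x y => [|j IH] f fgh x y.
  by rewrite big_ord0 !mul1g.
rewrite big_ord_recl -!mulgA.
have := fgh ord0; rewrite !inE => /orP[] /eqP ->.
  by rewrite (step gX) IH.
by rewrite (step gY) IH.
Qed.

(** Words of positive length have augmentation 0, so only the norm paired with the empty word
    contributes. *)
Lemma theta_aug Z : \sum_y theta Z 1%g y = 1.
Proof.
have q2 : (0 < 2 * q)%N by lia.
rewrite /theta exchange_big /= (bigD1 (Ordinal q2)) //=.
rewrite [X in _ + X]big1 => [|t]; last first.
  rewrite -val_eqE /= => /negPf t0; rewrite big_split /= -!mulr_sumr !altcoef_sum t0.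
  by rewrite subn_eq0 leqNgt ltn_ord !mulr0 addr0.
rewrite big_split /= -!mulr_sumr !altcoef_sum subn0 altcoef_top.
by rewrite (gtn_eqF q2) mulr0 !addr0 mul1r (altcoef_sum Z 0).
Qed.

(** * The Casimir element on a tensor product *)

Section Casimir.

Variables (m n : nat) (rM : reprG m) (rN : reprG n).
Variables (M : gen -> 'M[k]_m) (N : gen -> 'M[k]_n).
Hypothesis ME : forall Z, M Z = 1%:M + rM (s Z).
Hypothesis NE : forall Z, N Z = 1%:M + rN (s Z).

(** Elements acting on the tensor product are handled by slices: fixing the entry (a, b) in the
    first factor leaves an operator on the second. *)
Definition casimir Z a b : 'M[k]_n :=
  \sum_(t < 2 * q) (altop M (~~ Z) (2 * q - t) a b *: altop N Z t +
                    altop M Z t a b *: altop N (~~ Z) (2 * q - t)).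

(** The slice of the norm, the sum of all x tensor x. *)
Definition trace_mx a b : 'M[k]_n := \sum_x rM x a b *: rN x.

Definition casimir_unit Z : 'M[k]_n := \sum_z theta Z 1%g z *: rN z.

(** Substituting y = xz, invariance replaces [theta Z x y] by [theta Z 1 z], which splits off the
    norm. *)
Lemma casimirE Z a b : casimir Z a b = trace_mx a b *m casimir_unit Z.
Proof.
have altMN t t' Z1 Z2 : altop M Z1 t a b *: altop N Z2 t' =
    \sum_x \sum_y (altcoef Z1 t x * altcoef Z2 t' y * rM x a b) *: rN y.
  rewrite (altopE Z1 t ME) (altopE Z2 t' NE) summxE scaler_suml.
  apply: eq_bigr => x _; rewrite scaler_sumr; apply: eq_bigr => y _.
  by rewrite scalerA mxE mulrAC.
transitivity (\sum_x \sum_y (theta Z x y * rM x a b) *: rN y).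
  rewrite /casimir; under [LHS]eq_bigr do rewrite !altMN -big_split.
  rewrite exchange_big; apply: eq_bigr => x _ /=.
  under [LHS]eq_bigr do rewrite -big_split.
  rewrite exchange_big; apply: eq_bigr => y _ /=.
  by rewrite mulr_suml scaler_suml; apply: eq_bigr => t _; rewrite mulrDl scalerDl.
rewrite mulmx_suml; apply: eq_bigr => x _.
rewrite (reindex_inj (mulgI x)) mulmx_sumr; apply: eq_bigr => z _ /=.
rewrite -{1}[x]mulg1 theta_inv repr_mxM ?inE // mulrC -scalerA.
by rewrite -scalemxAl -scalemxAr.
Qed.

(** The action of x on the second factor is traded for that of its inverse on the first, so the rows
    of all slices span a submodule. *)
Lemma trace_mx_act a b x :
  trace_mx a b *m rN x = \sum_c rM x^-1%g c b *: trace_mx a c.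
Proof.
under [RHS]eq_bigr do rewrite scaler_sumr.
rewrite exchange_big (reindex_inj (mulIg x)) mulmx_suml; apply: eq_bigr => y _ /=.
rewrite -scalemxAl -repr_mxM ?inE // -{1}(mulgK x y) (repr_mxM rM) ?inE //.
rewrite mxE scaler_suml; apply: eq_bigr => c _.
by rewrite scalerA mulrC.
Qed.

(* The rows of all the trace_mx a b span a submodule killed by casimir_unit Z,
   while casimir_unit Z, of augmentation 1, fixes every fixed vector. *)
Lemma casimir_eq0 Z : (forall a b, casimir Z a b = 0) <-> (forall a b, trace_mx a b = 0).
Proof.
split=> [C0|T0] a b; last by rewrite casimirE T0 mul0mx.
pose S := (\sum_c \sum_d <<trace_mx c d>>)%MS.
have subS c d : (trace_mx c d <= S)%MS.
  by apply: (sumsmx_sup c) => //; apply: (sumsmx_sup d) => //; rewrite genmxE.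
have modS : mxmodule rN S.
  apply/mxmoduleP=> x _; rewrite sumsmxMr; apply/sumsmx_subP=> c _.
  rewrite sumsmxMr; apply/sumsmx_subP=> d _; rewrite (eqmxMr _ (genmxE _)) trace_mx_act.
  by apply: summx_sub => e _; apply: scalemx_sub.
have SV : S *m casimir_unit Z = 0.
  apply/eqP; rewrite -submx0 sumsmxMr; apply/sumsmx_subP=> c _.
  rewrite sumsmxMr; apply/sumsmx_subP=> d _; rewrite (eqmxMr _ (genmxE _)).
  by rewrite -casimirE C0.
apply/eqP; rewrite -submx0 (submx_trans (subS a b)) // submx0.
apply: contraT => nzS.
have pG := pgroup_card4q.
have [v [nzv vS fix_v]] := pgroup_fixed_row char2 pG modS nzS.
case/eqP: nzv; have : v *m casimir_unit Z = 0.
  by case/submxP: vS => D ->; rewrite -mulmxA SV mulmx0.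
rewrite mulmx_sumr; under eq_bigr do rewrite -scalemxAr fix_v ?inE //.
by rewrite -scaler_suml theta_aug scale1r.
Qed.

End Casimir.

End NormWord.

(** * Tensor products *)

Section TensorEntries.

Variable k : fieldType.

Lemma trow_entry n1 m2 n2 (i : 'I_m2) (j : 'I_(n1 * n2)) :
  exists b d, forall (A : 'rV[k]_n1) (B : 'M_(m2, n2)), trow A B i j = A 0 b * B i d.
Proof.
elim: n1 j => [|n1 IH] /=; first by case.
move=> j; case: (split_ordP (j : 'I_(n2 + n1 * n2))) => j' jE.
  exists ord0, j' => A B; rewrite jE row_mxEl !mxE; congr (A _ _ * _).
  exact: val_inj.
have [b [d bdE]] := IH j'; exists (rshift 1 b), d => A B.
by rewrite jE row_mxEr bdE mxE.
Qed.

Lemma tprod_entry m1 n1 m2 n2 (i : 'I_(m1 * m2)) (j : 'I_(n1 * n2)) :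
  exists a b c d, forall (A : 'M[k]_(m1, n1)) (B : 'M_(m2, n2)),
    tprod A B i j = A a b * B c d.
Proof.
elim: m1 i => [|m1 IH] /=; first by case.
move=> i; case: (split_ordP (i : 'I_(m2 + m1 * m2))) => i' iE.
  have [b [d bdE]] := trow_entry i' j.
  exists ord0, b, i', d => A B; rewrite iE col_mxEu bdE !mxE; congr (A _ _ * _).
  exact: val_inj.
have [a [b [c [d E]]]] := IH i'; exists (rshift 1 a), b, c, d => A B.
by rewrite iE col_mxEd E mxE.
Qed.

Lemma sum_tprod_eq0 (I : finType) (P : pred I) m n (A : I -> 'M[k]_m) (B : I -> 'M[k]_n) :
  \sum_(i | P i) tprod (A i) (B i) = 0 <->
  (forall a b, \sum_(i | P i) A i a b *: B i = 0).
Proof.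
split=> [AB0 a b | AB0].
  apply/matrixP=> c d; rewrite summxE mxE.
  (* [tprod_entry] does not say that every quadruple of indices occurs; multiplying by tensor
     products of basis vectors isolates any chosen one. *)
  pose l := tprod (delta_mx 0 a : 'rV[k]_m) (delta_mx 0 c : 'rV[k]_n).
  pose r := tprod (delta_mx b 0 : 'cV[k]_m) (delta_mx d 0 : 'cV[k]_n).
  have [a0 [b0 [c0 [d0 E]]]] := @tprod_entry 1 1 1 1 ord0 ord0.
  have := congr1 (fun C => l *m C *m r) AB0.
  rewrite mulmx0 mul0mx mulmx_sumr mulmx_suml => /matrixP/(_ ord0 ord0).
  rewrite summxE [RHS]mxE => lr0; apply: etrans lr0.
  apply: eq_bigr => i _; rewrite -!tprodE E !ord1 -!rowE -!colE !mxE.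
  by [].
apply/matrixP=> s t; have [a [b [c [d E]]]] := tprod_entry s t.
rewrite summxE [RHS]mxE; have := congr1 (fun C : 'M_n => C c d) (AB0 a b).
rewrite summxE [RHS]mxE => E0; apply: etrans E0.
by apply: eq_bigr => i _; rewrite E mxE.
Qed.

End TensorEntries.

(** * Longest non-vanishing words and the Casimir element *)

Section Profile.

Variable k : fieldType.

(* L is the largest length of a word not killing M, both words of length L
   being multiples of one operator; the last clause gives a matrix entry that
   detects a single word of length L - 1. *)
Definition profile n (M : gen -> 'M[k]_n) (L : nat) (a : gen -> k) : Prop :=
  [/\ forall Z t, (L < t)%N -> altop M Z t = 0,
      exists2 E, E != 0 & forall Z, altop M Z L = a Z *: E,
      exists Z, a Z != 0
    & (1 < L)%N -> forall Z, exists i j, altop M Z L.-1 i j != 0 /\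
        forall Z' t, (0 < t)%N -> (Z', t) <> (Z, L.-1) -> altop M Z' t i j = 0].

Lemma profile_casimir m n (M : gen -> 'M[k]_m) (N : gen -> 'M[k]_n) q L L' a a' :
  profile M L a -> profile N L' a' -> (L < 2 * q)%N -> (L' < 2 * q)%N ->
  (forall c d, casimir q M N gX c d = 0) <->
  (L + L' < 2 * q)%N \/
  (L + L' = 2 * q)%N /\ a gX * a' gY + a gY * a' gX = 0.
Proof.
move=> [M0 [E nzE ME] _ sepM] [N0 [E' nzE' NE] [Z nzZ] _] ltL ltL'.
pose F c d Z1 t := altop M Z1 t c d *: altop N (~~ Z1) (2 * q - t).
have F0 c d Z1 t : (L < t)%N || (L' < 2 * q - t)%N -> F c d Z1 t = 0.
  by case/orP=> [/M0 M1|/N0 N1]; rewrite /F ?M1 ?N1 ?scaler0 // mxE scale0r.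
(* Both halves of the Casimir sum are extended to t = 0..2q; the added terms, at t = 0 and t = 2q,
   vanish because L' < 2q and L < 2q. *)
have casE c d : casimir q M N gX c d = \sum_Z1 \sum_(t < (2 * q).+1) F c d Z1 t.
  rewrite big_bool /= [X in X + _]big_ord_recl [X in _ + X]big_ord_recr /=.
  rewrite F0 ?[X in _ + (_ + X)]F0 ?ltL ?subn0 ?ltL' ?orbT // add0r addr0.
  rewrite /casimir big_split; congr (_ + _).
  rewrite (reindex_inj rev_ord_inj) /=; apply: eq_bigr => t _; rewrite /F.
  by have -> : (2 * q - (2 * q - t.+1) = t.+1)%N by have := ltn_ord t; lia.
have [lt_q|le_q] := ltnP (L + L') (2 * q).
  split=> [_|_ c d]; first by left.
  by rewrite casE; apply: big1 => Z1 _; apply: big1 => t _; apply: F0; lia.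
have ltLq : (L < (2 * q).+1)%N by lia.
move: le_q; rewrite leq_eqVlt => /orP[/eqP eq_q|lt_q].
  have {casE} casE c d : casimir q M N gX c d =
      (a gX * a' gY + a gY * a' gX) * E c d *: E'.
    have FL Z1 : \sum_(t < (2 * q).+1) F c d Z1 t = a Z1 * a' (~~ Z1) * E c d *: E'.
      rewrite (bigD1 (Ordinal ltLq)) //= big1 ?addr0 => [|t].
        have -> : F c d Z1 L = altop M Z1 L c d *: altop N (~~ Z1) L'.
          by rewrite /F; congr (_ *: altop _ _ _); lia.
        by rewrite ME NE mxE scalerA; congr (_ *: _); rewrite mulrAC.
      by rewrite -val_eqE /= => tL; apply: F0; lia.
    by rewrite casE big_bool /= !FL -scalerDl -mulrDl addrC.
  split=> [C0|[//|[_ a0] c d]]; last by rewrite casE a0 mul0r scale0r.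
  right; split=> //; have [i [j nzij]] := matrix0Pn _ nzE.
  move/eqP: (C0 i j); rewrite casE scaler_eq0 (negPf nzE') orbF.
  by rewrite mulf_eq0 (negPf nzij) orbF => /eqP.
split=> [C0|]; last by lia.
(* The entry (i, j) isolates the word of M of length L - 1 starting with [~~ Z]. Its partner in N
   starts with Z and has length 2q - L + 1, at most L', so it is an initial part of a non-zero
   word. *)
have [|i [j [nzij sep_ij]]] := sepM _ (~~ Z); first by lia.
have ltL1 : (L.-1 < (2 * q).+1)%N by lia.
have := C0 i j; rewrite casE (bigD1 (~~ Z)) //= [X in _ + X]big1 => [|Z1 Z1Z].
  rewrite (bigD1 (Ordinal ltL1)) //= big1 => [|t].
    move/eqP; rewrite !addr0 scaler_eq0 (negPf nzij) negbK /=.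
    have : altop N Z L' != 0 by rewrite NE scaler_eq0 negb_or nzZ.
    move=> nzL' /eqP N1; case/eqP: nzL'; apply: altop_eq0 N1; lia.
  rewrite -val_eqE /= => tL; case: (posnP t) => [t0|t_gt0].
    by apply: F0; rewrite t0; lia.
  by rewrite /F sep_ij ?scale0r // => -[tE]; rewrite tE eqxx in tL.
apply: big1 => t _; case: (posnP t) => [t0|t_gt0].
  by apply: F0; rewrite t0; lia.
by rewrite /F sep_ij ?scale0r // => -[ZE _]; rewrite ZE eqxx in Z1Z.
Qed.

End Profile.

Section Criterion.
Variables (k : fieldType) (gT : finGroupType) (q : nat) (g h : gT).
Hypotheses (char2 : 2%N \in [pchar k]) (q_ge2 : (2 <= q)%N).
Hypotheses (q_pow : exists e, q = (2 ^ e)%N) (oG : #|gT| = (4 * q)%N).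
Hypothesis ghP : dihedral_gens q g h.

Lemma tensor_summandP m n (rM : mx_representation k [set: gT] m)
    (rN : mx_representation k [set: gT] n) (M : gen -> 'M_m) (N : gen -> 'M_n) 
    L L' a a' :
  (forall Z, M Z = 1%:M + rM (gpt g h Z)) ->
  (forall Z, N Z = 1%:M + rN (gpt g h Z)) ->
  profile M L a -> profile N L' a' -> (L < 2 * q)%N -> (L' < 2 * q)%N ->
  has_proj_summand (prod_repr rM rN) <->
  (2 * q < L + L')%N \/
  (L + L' = 2 * q)%N /\ a gX * a' gY + a gY * a' gX != 0.
Proof.
move=> ME NE pM pN ltL ltL'.
have pG := pgroup_card4q q_pow oG.
apply: (iff_trans (has_proj_summandP char2 pG _)).
have := profile_casimir pM pN ltL ltL'.
have := casimir_eq0 char2 q_ge2 q_pow oG ghP ME NE gX.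
have := sum_tprod_eq0 predT rM rN.
have -> : \sum_(i | predT i) tprod (rM i) (rN i) = norm_mx (prod_repr rM rN).
  by apply: eq_bigl => x; rewrite [RHS]inE.
move=> N0 C0 lenE.
have {}N0 : norm_mx (prod_repr rM rN) = 0 <-> (L + L' < 2 * q)%N \/
    (L + L' = 2 * q)%N /\ a gX * a' gY + a gY * a' gX = 0.
  exact: (iff_trans N0 (iff_trans (iff_sym C0) lenE)).
split=> [nzN | len]; last first.
  apply/eqP=> /N0; case: len => [|[-> /eqP nz]]; first lia.
  by case=> [|[_ //]]; lia.
have [lt_q|lt_q|eq_q] := ltngtP (L + L') (2 * q); [|by left|].
  by case/eqP: nzN; apply/N0; left.
right; split=> //; apply: contraNneq nzN => a0; apply/eqP/N0; right.
by [].
Qed.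
End Criterion.

(** * String and band modules *)

Lemma bitS n i : bit n i.+1 = bit n./2 i.
Proof. by rewrite /bit expnS divnMA divn2. Qed.

Lemma bit0 n : bit n 0 = odd n.
Proof. by rewrite /bit divn1 modn2. Qed.

(** An odd sum has exactly one odd summand, and the halves again add up to a number of the form 2^e
    - 1. *)
Lemma perp_complement e l m : (l + m = (2 ^ e).-1)%N -> perp l m.
Proof.
elim: e l m => [|e IH] l m lm i.
  by have [-> ->] : l = 0%N /\ m = 0%N by [lia]; rewrite /bit div0n mod0n.
have lm2 : (l./2 + m./2 = (2 ^ e).-1)%N by rewrite expnS in lm; lia.
case: i => [|i]; last by rewrite !bitS; apply: IH.
by rewrite !bit0; have := expn_gt0 2 e; rewrite expnS in lm; lia.
Qed.

Lemma perp_ltn l m : perp l m ->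
  forall e, (l < 2 ^ e)%N -> (m < 2 ^ e)%N -> (l + m < 2 ^ e)%N.
Proof.
move=> lm e; elim: e l m lm => [|e IH] l m lm; first by lia.
rewrite expnS => ltl ltm; have := lm 0%N; rewrite !bit0.
have := IH l./2 m./2; have lm2 : perp l./2 m./2.
  by move=> i; rewrite -!bitS.
by move=> /(_ lm2); lia.
Qed.

(** * String modules of words without inverse letters *)

Section StringModule.

Variables (k : fieldType) (w : word) (Z0 : gen).
Local Notation l := (size w).
Hypothesis wE : forall i, (i < l)%N ->
  nth (gX, false) w i = ((odd i == odd l) (+) Z0, false).

(** [Z0] is the last letter of a non-empty w, so Y gives the words A and X the words B. *)
Lemma string_mxE Z i j : string_mx k w Z i j =
  ((Z == odd i (+) odd l (+) Z0) && (i == j + 1 :> nat)%N)%:R.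
Proof.
have li : (i <= l)%N := ltn_ord i.
rewrite mxE /wletter; case: ifP => [/andP[i_gt0]|]; last first.
  case: (nat_of_ord i) li => [|i'] li /=.
    move=> _; rewrite addn1 andbF; case: ltnP => //= l_gt0.
    by rewrite wE // xpair_eqE andbF.
  rewrite wE // xpair_eqE andbT => /negbT Z1.
  have -> : (i'.+1 < l)%N && (nth (gX, false) w i'.+1 == (Z, true)) = false.
    by apply/negbTE/negP=> /andP[lt_i]; rewrite /= wE // xpair_eqE andbF.
  by case: (odd i') Z1; case: (odd l); case: Z0; case: Z.
case: (nat_of_ord i) li i_gt0 => [|i'] // li _.
rewrite /= wE // xpair_eqE andbT addn1 => /eqP <-.
by case: (odd i'); case: (odd l); case: Z0.
Qed.

Lemma string_altopE Z t i j : (0 < t)%N -> altop (string_mx k w) Z t i j =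
  ((Z == odd i (+) odd l (+) Z0) && (i == j + t :> nat)%N)%:R.
Proof.
case: t => // t _; elim: t Z i => [|t IH] Z i; first by rewrite /= mulmx1 string_mxE.
rewrite [altop _ _ _]/(string_mx k w Z *m altop _ (~~ Z) t.+1) mxE.
case: (posnP i) => [i0|i_gt0].
  rewrite big1 => [|s _]; first by rewrite i0 addnS andbF.
  by rewrite string_mxE i0 addn1 andbF mul0r.
have lti : (i.-1 < l.+1)%N by rewrite (leq_ltn_trans (leq_pred i)).
rewrite (bigD1 (Ordinal lti)) //= big1 => [|s]; last first.
  rewrite -val_eqE /= => si; rewrite string_mxE.
  have -> : (i == s + 1 :> nat)%N = false by lia.
  by rewrite andbF mul0r.
rewrite IH string_mxE /= addr0 addn1 prednK // eqxx andbT -natrM mulnb; congr (_%:R).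
have -> : (i.-1 == j + t.+1)%N = (i == j + t.+2 :> nat)%N by lia.
have -> : odd i.-1 = ~~ odd i by lia.
by case: (nat_of_ord i == _); case: (odd i); case: (odd l); case: Z0; case: Z.
Qed.

Lemma string_profile :
  profile (string_mx k w) l (fun Z => ((l == 0%N) || (Z == Z0))%:R).
Proof.
have alt0 t Z : t = 0%N -> altop (string_mx k w) Z t = 1%:M by move->.
split.
- move=> Z t ltl; apply/matrixP=> i j; rewrite string_altopE ?mxE; last by lia.
  by have := ltn_ord i; rewrite andbC; case: eqP => //; lia.
- exists (altop (string_mx k w) Z0 l).
    apply/matrix0Pn; exists ord_max, ord0; case: (posnP l) => [l0|l_gt0].
      by rewrite alt0 // mxE -val_eqE /= {1}l0 oner_eq0.
    by rewrite string_altopE //= addbb eqxx add0n eqxx oner_eq0.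
  move=> Z; case: (posnP l) => [l0|l_gt0].
    by rewrite !alt0 // scale1r.
  have [->|neqZ] := eqVneq Z Z0; first by rewrite orbT scale1r.
  rewrite scale0r; apply/matrixP=> i j.
  rewrite string_altopE // mxE; case: andP => // -[/eqP ZE /eqP iE].
  have il : i = l :> nat by have := ltn_ord i; lia.
  by rewrite ZE il addbb eqxx in neqZ.
- by exists Z0; rewrite eqxx orbT oner_eq0.
move=> l_gt1 Z; have l1 : (1 < l.+1)%N by lia.
have lp : (l.-1 < l.+1)%N by lia.
(* The path from e_l to e_0 starts with [Z0]. Length l - 1 is detected by dropping its last step if
   Z = [Z0], and its first step otherwise. *)
have [->|neqZ] := eqVneq Z Z0.
  exists ord_max, (Ordinal l1); split=> [|Z' t t_gt0 neq].
    rewrite string_altopE /= ?addbb ?eqxx; last by lia.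
    by have -> : (l == 1 + l.-1)%N by [lia]; rewrite oner_eq0.
  rewrite string_altopE //= addbb addFb; case: andP => // -[/eqP ZE /eqP lE].
  by case: neq; rewrite ZE lE.
exists (Ordinal lp), ord0; have -> : Z = ~~ Z0 by case: Z Z0 neqZ => [] [].
have oddp : odd l.-1 = ~~ odd l by lia.
split=> [|Z' t t_gt0 neq].
  rewrite string_altopE /= ?oddp ?add0n ?eqxx ?andbT; last by lia.
  by case: (odd l); case: Z0; rewrite oner_eq0.
rewrite string_altopE //= oddp add0n; case: andP => // -[/eqP ZE /eqP lE].
by case: neq; rewrite ZE lE; case: (odd l); case: Z0.
Qed.

End StringModule.

(** Row 0, the only one containing rho^-1, is excluded: inverse letters of the band act only from
    index l1 > 0 on. *)
Lemma bandT_inv (k : fieldType) n (rho : k) (i j : 'I_n) : (1 < n)%N ->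
  rho != 0 -> (0 < i)%N ->
  invmx (bandT n rho) i j = (j == (if i.+1 == n then 0 else i.+1) :> nat)%N%:R.
Proof.
move=> n_gt1 rho0 i_gt0.
pose T := bandT n rho.
pose S : 'M[k]_n := \matrix_(i, j)
  (if i == 0%N :> nat then (if j == 1%N :> nat then rho^-1 else 0)
   else (j == (if i.+1 == n then 0 else i.+1) :> nat)%N%:R).
have ST : S *m T = 1%:M.
  apply/matrixP=> a b; rewrite mxE [RHS]mxE.
  have lts : ((if a.+1 == n then 0 else a.+1) < n)%N.
    by have := ltn_ord a; case: eqP; lia.
  rewrite (bigD1 (Ordinal lts)) //= big1 ?addr0 => [|c]; last first.
    rewrite -val_eqE /= [S _ _]mxE; case: (posnP a) => [->|a_gt0] /negPf cE.
      by move: cE; rewrite (ltn_eqF n_gt1) => ->; rewrite mul0r.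
    by rewrite cE mul0r.
  rewrite !mxE /= -val_eqE /=; have := ltn_ord a; have := ltn_ord b.
  case: (posnP a) => [->|a_gt0] ltb lta.
    rewrite (ltn_eqF n_gt1) /=; case: (posnP b) => [->|b_gt0]; first by rewrite mulVf.
    by rewrite mulr0 ltn_eqF.
  rewrite eqxx mul1r; case: (a.+1 =P n) => [an|an] /=; first by congr (_%:R); lia.
  by rewrite gtn_eqF //; congr (_%:R); lia.
have [_ uT] := mulmx1_unit ST.
have -> : invmx T = S by rewrite -[LHS]mul1mx -ST mulmxK.
by rewrite mxE gtn_eqF.
Qed.

(** * Band modules *)

Section BandModule.

Variables (k : fieldType) (l1 l2 : nat) (rho : k).
Hypotheses (l1_gt0 : (0 < l1)%N) (l2_gt0 : (0 < l2)%N) (odd_l : odd l1 = odd l2).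
Hypothesis rho0 : rho != 0.
Local Notation w := (wAB l1 l2).
Local Notation n := (size w).

(* The words starting with Y descend from e_l1 along A_l1, and those starting
   with X ascend along B_l2^-1 and wrap around to e_0. *)
Definition band_entry Z t (i j : nat) : k :=
  if (0 < i <= l1)%N && (Z == (odd i == odd l1))
  then (if (j + t == i)%N then (if j == 0%N then rho else 1) else 0)
  else if (l1 <= i)%N && (Z == (odd i != odd l1))
  then ((j == i + t) || (i + t == l1 + l2) && (j == 0))%N%:R else 0.

Lemma band_mxE Z i j : band_mx w rho Z i j = band_entry Z 1 i j.
Proof.
have sz := size_wAB l1 l2.
have lti := ltn_ord i; rewrite [X in (_ < X)%N]sz in lti.
have ltj := ltn_ord j; rewrite [X in (_ < X)%N]sz in ltj.
have L i' : (i' <= l1 + l2)%N -> wletter w i' =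
    (odd i' == odd l1, (i' == 0%N) || (l1 < i')%N).
  case: i' => [|i'] lei; rewrite /wletter nth_wAB ?sz //; try lia;
    by congr pair; lia.
rewrite mxE !L ?(ltnW lti) // !xpair_eqE /band_entry.
rewrite andbC eqbF_neg negb_or -lt0n -leqNgt [odd i == odd l1 == Z]eq_sym.
case: ifP => [/andP[/andP[i_gt0 il] _]|_].
  rewrite mxE (gtn_eqF i_gt0); case: ifP => [/eqP ->|i1].
    have -> : (j + 1 == 1)%N = (j == 0%N :> nat). lia.
    by case: (nat_of_ord j == 0%N).
  have -> : (j + 1 == i)%N = (j == i.-1 :> nat) by lia.
  by case: eqP => // jE; rewrite (_ : (j == 0%N :> nat) = false) //; lia.
rewrite /= eqb_id andbC ltnS.
have -> : ((~~ odd i == odd l1) == Z) = (Z == (odd i != odd l1)).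
  by case: (odd i); case: (odd l1); case: Z.
case: ifP => // /andP[l1i _].
rewrite bandT_inv //; [|by rewrite sz; lia|by lia].
by case: (i.+1 =P n) => iE; congr (_%:R); lia.
Qed.

Lemma band_altopE Z t i j : (0 < t)%N ->
  altop (band_mx w rho) Z t i j = band_entry Z t i j.
Proof.
have sz := size_wAB l1 l2.
case: t => // t _; elim: t Z i => [|t IH] Z i; first by rewrite /= mulmx1 band_mxE.
rewrite [altop _ _ _]/(band_mx w rho Z *m altop _ (~~ Z) t.+1) mxE.
have lti := ltn_ord i; rewrite [X in (_ < X)%N]sz in lti.
have ltj := ltn_ord j; rewrite [X in (_ < X)%N]sz in ltj.
case A: ((0 < i <= l1)%N && (Z == (odd i == odd l1))).
  have [/andP[i_gt0 il] ZE] := andP A.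
  have ltp : (i.-1 < n)%N := leq_ltn_trans (leq_pred i) (ltn_ord i).
  rewrite (bigD1 (Ordinal ltp)) //= big1 => [|s]; last first.
    rewrite -val_eqE /= => si; rewrite band_mxE /band_entry A.
    by case: eqP; rewrite ?mul0r //; lia.
  rewrite IH band_mxE /band_entry A /= addr0.
  have -> : (i.-1 + 1)%N == i by lia.
  have -> : (j + t.+2 == i)%N = (j + t.+1 == i.-1)%N by lia.
  case: (posnP i.-1) => [i0|ip_gt0].
    have -> : (l1 <= i.-1)%N = false by lia.
    have -> : (j + t.+1 == i.-1)%N = false by lia.
    by rewrite mulr0.
  have -> : (i.-1 <= l1)%N by lia.
  have -> : ~~ Z == (odd i.-1 == odd l1) by move/eqP: ZE => ->; lia.
  by rewrite mul1r.
case B: ((l1 <= i)%N && (Z == (odd i != odd l1))); last first.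
  rewrite big1 => [|s _]; first by rewrite /band_entry A B.
  by rewrite band_mxE /band_entry A B mul0r.
have [il ZE] := andP B.
have ltp : ((if i.+1 == l1 + l2 then 0 else i.+1) < n)%N by case: eqP; lia.
rewrite (bigD1 (Ordinal ltp)) //= big1 => [|s]; last first.
  rewrite -val_eqE /= => si; rewrite band_mxE /band_entry A B.
  have lts := ltn_ord s; rewrite [X in (_ < X)%N]sz in lts.
  by case E: (_ || _); rewrite ?mul0r //; move: E si; case: (i.+1 =P (l1 + l2)%N); lia.
rewrite IH band_mxE /band_entry A B /= addr0.
(* A path that has wrapped around to e_0 ends there, since both letters kill e_0. *)
case: (i.+1 =P (l1 + l2)%N) => iE.
  rewrite addn1 iE eqxx orbT mul1r /= (leqNgt l1) l1_gt0 /=.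
  have -> : (j == i + t.+2 :> nat)%N = false by lia.
  by have -> : (i + t.+2 == l1 + l2)%N = false by lia.
have -> : (i.+1 <= l1)%N = false by lia.
have -> : ~~ Z == (odd i.+1 != odd l1) by move/eqP: ZE => ->; lia.
by rewrite (leqW il) addn1 eqxx mul1r addSnnS.
Qed.

(** Two paths lead from e_l1 to e_0: one of length l1 starting with Y, of weight rho, and one of
    length l2 starting with X, of weight 1. Only those of maximal length count. *)
Definition band_top (Z : gen) : k :=
  if Z then (if (l2 <= l1)%N then rho else 0) else (l1 <= l2)%N%:R.

Lemma band_entry_top Z (i j : 'I_n) :
  band_entry Z (maxn l1 l2) i j =
  if (i == l1 :> nat)%N && (j == 0 :> nat)%N then band_top Z else 0.
Proof.
have sz := size_wAB l1 l2.
have lti := ltn_ord i; rewrite [X in (_ < X)%N]sz in lti.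
have ltj := ltn_ord j; rewrite [X in (_ < X)%N]sz in ltj.
rewrite /band_entry /band_top; case: (nat_of_ord i =P l1) => [->|il] /=.
  rewrite l1_gt0 leqnn eqxx eqb_id; case: Z => /=.
    have -> : (j + maxn l1 l2 == l1)%N = (l2 <= l1)%N && (j == 0 :> nat)%N by lia.
    by case: leqP => _; case: (nat_of_ord j == 0%N).
  have -> : (j == l1 + maxn l1 l2 :> nat)%N = false by lia.
  have -> : (l1 + maxn l1 l2 == l1 + l2)%N = (l1 <= l2)%N by lia.
  by case: (nat_of_ord j == 0%N); rewrite ?andbF ?andbT.
case: ifP => [/andP[/andP[_ il1] _]|_].
  by have -> : (j + maxn l1 l2 == i)%N = false by lia.
case: ifP => // /andP[l1i _].
have -> : (j == i + maxn l1 l2 :> nat)%N = false by lia.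
by have -> : (i + maxn l1 l2 == l1 + l2)%N = false by lia.
Qed.

Lemma band_profile : profile (band_mx w rho) (maxn l1 l2) band_top.
Proof.
have sz := size_wAB l1 l2.
have lt0 : (0 < n)%N by lia.
have lt1 : (l1 < n)%N by lia.
have L_gt0 : (0 < maxn l1 l2)%N by lia.
split.
- move=> Z t ltt; apply/matrixP=> i j; rewrite band_altopE ?mxE; last by lia.
  have lti := ltn_ord i; rewrite [X in (_ < X)%N]sz in lti.
  have ltj := ltn_ord j; rewrite [X in (_ < X)%N]sz in ltj.
  rewrite /band_entry; case: ifP => [/andP[/andP[_ il] _]|_].
    by have -> : (j + t == i)%N = false by lia.
  case: ifP => // /andP[l1i _]; have -> : (j == i + t :> nat)%N = false by lia.
  by have -> : (i + t == l1 + l2)%N = false by lia.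
- exists (delta_mx (Ordinal lt1) (Ordinal lt0)) => [|Z].
    apply/matrix0Pn; exists (Ordinal lt1), (Ordinal lt0).
    by rewrite mxE !eqxx oner_eq0.
  apply/matrixP=> i j; rewrite band_altopE // band_entry_top !mxE -!val_eqE /=.
  by case: ifP; rewrite ?mulr1 ?mulr0.
- case: (leqP l1 l2) => ll; [exists gX | exists gY]; rewrite /= ?ll ?oner_eq0 //.
  by rewrite ltnW.
move=> L_gt1 Z.
suff [i [j [ltin [ltjn [nz sep]]]]] : exists i j, (i < n)%N /\ ((j < n)%N /\
    (band_entry Z (maxn l1 l2).-1 i j != 0 /\ forall Z' t, (0 < t)%N ->
       (Z' = Z -> t <> (maxn l1 l2).-1) -> band_entry Z' t i j = 0)).
  exists (Ordinal ltin), (Ordinal ltjn); rewrite band_altopE; last by lia.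
  split=> // Z' t t_gt0 neq; rewrite band_altopE //; apply: sep => // ZE tE.
  by apply: neq; rewrite ZE tE.
have neqF (a b : nat) : a <> b -> (a == b) = false by move/eqP/negPf.
(* A longest path from e_l1 to e_0 is shortened by one step: at its end if it starts with Z, at its
   beginning otherwise. *)
case: Z.
  have [ll|ll] := leqP l2 l1.
    exists l1, 1%N; split; [by []|split; first by lia].
    rewrite /band_entry l1_gt0 leqnn eqxx eqb_id /=; split=> [|[] t t_gt0 neq].
    - by rewrite ifT ?oner_eq0 //; lia.
    - by rewrite neqF //=; have := neq erefl; lia.
    by rewrite /= andbF orbF neqF //; lia.
  exists l1.+1, 0%N; split; [by lia|split; first by []].
  have oddS : (odd l1.+1 != odd l1) = true by rewrite /=; case: (odd l1).
  rewrite /band_entry ltnn leqnSn oddS /=; split=> [|[] t t_gt0 neq] //=.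
    have -> : (l1.+1 + l2.-1 == l1 + l2)%N by lia.
    by rewrite oner_eq0.
  by rewrite andbT neqF //; have := neq erefl; lia.
have [ll|ll] := leqP l1 l2.
  exists l1, n.-1; split; [by []|split; first by lia].
  rewrite /band_entry l1_gt0 leqnn eqxx /=; split=> [|[] t t_gt0 neq] //=.
  - have -> : (n.-1 == l1 + l2.-1)%N by lia.
    by rewrite oner_eq0.
  - by rewrite neqF //; lia.
  have -> : (n.-1 == 0)%N = false by lia.
  by rewrite andbF orbF neqF //; have := neq erefl; lia.
exists l1.-1, 0%N; split; [by lia|split; first by []].
rewrite /band_entry; have -> : (odd l1.-1 == odd l1) = false by lia.
have -> : (l1 <= l1.-1)%N = false by lia.
rewrite leq_pred; have -> : (0 < l1.-1)%N by lia.
split=> [|[] t t_gt0 neq] //=; first by rewrite eqxx.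
by rewrite neqF //; have := neq erefl; lia.
Qed.

End BandModule.

(** * The five families of tensor products *)

Theorem corollary9 (k : fieldType) (q : nat) (g h : 'D_(4 * q))
    (l m l1 l2 m1 m2 : nat) (rho sigma : k)
    (MAl : Drepr k q (size (wA l)).+1)
    (MAm : Drepr k q (size (wA m)).+1)
    (MBm : Drepr k q (size (wB m)).+1)
    (Ml : Drepr k q (size (wAB l1 l2)))
    (Mm : Drepr k q (size (wAB m1 m2))) :
  2%N \in [pchar k] ->
  (2 <= q)%N -> (exists e, q = (2 ^ e)%N) ->
  dihedral_gens q g h ->
  (l < 2 * q)%N -> (m < 2 * q)%N ->
  (0 < l1 < 2 * q)%N -> (0 < l2 < 2 * q)%N ->
  (0 < m1 < 2 * q)%N -> (0 < m2 < 2 * q)%N ->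
  inWprime (wAB l1 l2) -> inWprime (wAB m1 m2) ->
  rho != 0 -> sigma != 0 ->
  is_module_of g h (string_mx k (wA l)) MAl ->
  is_module_of g h (string_mx k (wA m)) MAm ->
  is_module_of g h (string_mx k (wB m)) MBm ->
  is_module_of g h (band_mx (wAB l1 l2) rho) Ml ->
  is_module_of g h (band_mx (wAB m1 m2) sigma) Mm ->
  [/\ tensor_has_proj MAl MBm <-> (2 * q <= l + m)%N,
      tensor_has_proj MAl MAm <-> (2 * q + 1 <= l + m)%N,
      tensor_has_proj Ml MAm <-> (2 * q <= maxn (l1 + m - 1) (l2 + m))%N,
      l1 <> l2 \/ m1 <> m2 ->
        (tensor_has_proj Ml Mm <->
         (2 * q <= maxn (maxn (l1 + m1 - 1) (l1 + m2))
                        (maxn (l2 + m1) (l2 + m2 - 1)))%N)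
    & l1 = l2 -> m1 = m2 ->
        (tensor_has_proj Ml Mm <->
         (~ perp l1 (m1 - 1) /\ (2 * q <= l1 + m1)%N) \/
         [/\ perp l1 (m1 - 1), rho <> sigma & (l1 + m1 = 2 * q)%N])].
Proof.
move=> char2 q_ge2 q_pow ghP ltl ltm /andP[l1_gt0 ltl1] /andP[l2_gt0 ltl2].
move=> /andP[m1_gt0 ltm1] /andP[m2_gt0 ltm2].
move=> /(wAB_Wprime l1_gt0 l2_gt0) odd_l /(wAB_Wprime m1_gt0 m2_gt0) odd_m.
move=> rho0 sigma0 isAl isAm isBm isl ism.
have oG : #|'D_(4 * q)| = (4 * q)%N.
  have -> : (4 * q = (2 * q).*2)%N by lia.
  by rewrite -cardsT card_dihedral //; lia.
have genE n (M : gen -> 'M[k]_n) (rM : Drepr k q n) : is_module_of g h M rM ->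
  forall Z, M Z = 1%:M + rM (gpt g h Z) by case=> MX MY; case.
have sA t : size (wA t) = t by case: (wA_wB t).
have sB t : size (wB t) = t by case: (wA_wB t).
have profA t : profile (string_mx k (wA t)) t (fun Z => ((t == 0%N) || (Z == gY))%:R).
  have := @string_profile k (wA t) gY; move: (profile _) => P; rewrite sA; apply.
  by move=> i lti; case: (wA_wB t) => _ _ /(_ i lti)[-> _]; rewrite addbT.
have profB t : profile (string_mx k (wB t)) t (fun Z => ((t == 0%N) || (Z == gX))%:R).
  have := @string_profile k (wB t) gX; move: (profile _) => P; rewrite sB; apply.
  by move=> i lti; case: (wA_wB t) => _ _ /(_ i lti)[_ ->]; rewrite addbF.
have profl := band_profile l1_gt0 l2_gt0 odd_l rho0.
have profm := band_profile m1_gt0 m2_gt0 odd_m sigma0.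
have ltL : (maxn l1 l2 < 2 * q)%N by rewrite gtn_max ltl1.
have ltM : (maxn m1 m2 < 2 * q)%N by rewrite gtn_max ltm1.
have crit m' n' := @tensor_summandP k _ q g h char2 q_ge2 q_pow oG ghP m' n'.
split.
- apply: (iff_trans (crit _ _ _ _ _ _ _ _ _ _
    (genE _ _ _ isAl) (genE _ _ _ isBm) (profA l) (profB m) ltl ltm)).
  rewrite /= !orbT !orbF mulr1; split; first by case=> [|[]]; lia.
  rewrite leq_eqVlt => /orP[/eqP eq_q|]; [right; split=> //|by left].
  have [-> ->] : (l == 0%N) = false /\ (m == 0%N) = false by lia.
  by rewrite mul0r add0r oner_eq0.
- apply: (iff_trans (crit _ _ _ _ _ _ _ _ _ _
    (genE _ _ _ isAl) (genE _ _ _ isAm) (profA l) (profA m) ltl ltm)).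
  rewrite /= !orbT !orbF mulr1 mul1r; split; last by left; lia.
  case=> [|[eq_q]]; first by lia.
  have [-> ->] : (l == 0%N) = false /\ (m == 0%N) = false by lia.
  by rewrite add0r eqxx.
- apply: (iff_trans (crit _ _ _ _ _ _ _ _ _ _
    (genE _ _ _ isl) (genE _ _ _ isAm) profl (profA m) ltL ltm)).
  rewrite /band_top /= orbT orbF mulr1.
  (* When the maximal lengths add up to 2q, m is positive and only the X-coefficient of the band
     matters. It is non-zero exactly for l1 <= l2, whence the -1 attached to l1. *)
  have [l12|l21|l12] := ltngtP l1 l2; rewrite ?mul0r ?addr0.
  + split; first by case=> [|[]]; lia.
    rewrite leq_max => le_q; have [|eq_q] : (2 * q < l2 + m)%N \/ (l2 + m = 2 * q)%N by lia.
      by left.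
    by right; split=> //; rewrite oner_eq0.
  + split; last by left; lia.
    case=> [|[eq_q]]; first by lia.
    have -> : (m == 0%N) = false by lia.
    by rewrite mulr0 addr0 eqxx.
  split; first by case=> [|[]]; lia.
  rewrite leq_max => le_q; have [|eq_q] : (2 * q < l1 + m)%N \/ (l1 + m = 2 * q)%N by lia.
    by left.
  right; split=> //; have -> : (m == 0%N) = false by lia.
  by rewrite mulr0 addr0 oner_eq0.
- move=> neq; apply: (iff_trans (crit _ _ _ _ _ _ _ _ _ _
    (genE _ _ _ isl) (genE _ _ _ ism) profl profm ltL ltM)).
  rewrite /band_top /=.
  (* Unless l1 = l2 and m1 = m2, at most one of the two products of top coefficients is non-zero, so
     nothing can cancel. *)
  have [l12|l12|l12] := ltngtP l1 l2; have [m12|m12|m12] := ltngtP m1 m2;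
    rewrite ?mulr0 ?mul0r ?mulr1 ?mul1r ?addr0 ?add0r ?eqxx ?rho0 ?sigma0.
  all: rewrite ?andbT; try by clear - l12 m12 l1_gt0 m1_gt0;
    rewrite !leq_max; split=> [[|[]]|]; lia.
  by case: neq.
move=> l12 m12; apply: (iff_trans (crit _ _ _ _ _ _ _ _ _ _
    (genE _ _ _ isl) (genE _ _ _ ism) profl profm ltL ltM)).
rewrite /band_top /= -l12 -m12 !leqnn !maxnn mul1r mulr1.
have nzE : (sigma + rho != 0) = (rho != sigma).
  rewrite -[X in _ + X]opprK subr_eq0 eq_sym; congr (~~ (_ == _)).
  by apply/eqP; rewrite -subr_eq0 -opprD oppr_eq0; apply/eqP/(addrr_char2 char2).
rewrite nzE; have [e qE] := q_pow; have q2E : (2 * q = 2 ^ e.+1)%N by rewrite expnS qE.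
(* With 2q = 2^(e+1), l1 + m1 = 2q forces l1 and m1 - 1 to have complementary digits, while l1 + m1
   > 2q produces a carry. *)
split=> [[lt_q|[eq_q /eqP neq]]|[[nperp le_q]|[perp_lm /eqP neq eq_q]]].
- left; split; last exact: ltnW.
  by move=> /perp_ltn /(_ e.+1); rewrite -q2E; lia.
- right; split=> //; apply: (@perp_complement e.+1); rewrite -q2E; lia.
- left; rewrite ltn_neqAle le_q andbT; apply/negP=> /eqP eq_q.
  by apply: nperp; apply: (@perp_complement e.+1); rewrite -q2E; lia.
- by right; split.
Qed.
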